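(* Let $K$ be a field with characteristic different from $2$ and $3$. Let $\psi(z)\in K(z)$ have degree $2$, and let $\lambda_1,\lambda_2,\lambda_3\in\overline K$ be the multipliers of the fixed points of $\psi$ (counted with multiplicity). (a) If the multipliers are distinct or if exactly two multipliers are $1$, then $\psi(z)$ is conjugate over $K$ to the map $$\phi(z)=\frac{2z^2+(2-\sigma_1)z+(2-\sigma_1)}{-z^2+(2+\sigma_1)z+2-\sigma_1-\sigma_2}\in K(z),$$ where $\sigma_1=\lambda_1+\lambda_2+\lambda_3$ and $\sigma_2=\lambda_1\lambda_2+\lambda_1\lambda_3+\lambda_2\lambda_3$ are the first two symmetric functions of the multipliers. Furthermore, no two distinct maps of this form are conjugate to each other over $\overline K$. (b) If $\lambda_1=\lambda_2\neq 1$ and $\lambda_3\neq\lambda_1$ (for some ordering of the multipliers), or if $\lambda_1=\lambda_2=\lambda_3=1$, then $\psi$ is conjugate over $K$ to a map of the form $$\phi_{k,b}(z)=kz+\frac bz$$ with $k\in K\smallsetminus\{0,-1/2\}$ (in fact, $k=\frac{\lambda_1+1}{2}$) and $b\in K^*$. Furthermore, two such maps $\phi_{k,b}$ and $\phi_{k',b'}$ are conjugate over $\overline K$ if and only if $k=k'$; they are conjugate over $K$ if in addition $b/b'\in(K^* )^2$. (c) If $\lambda_1=\lambda_2=\lambda_3=-2$, then $\psi$ is conjugate over $K$ to a map of the form $$\theta_{d,k}(z)=\frac{kz^2-2dz+dk}{z^2-2kz+d},\qquad\text{with } k\in K,\ d\in K^*,\ \text{and } k^2\neq d.$$ All such maps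 are conjugate over $\overline K$. Furthermore, $\theta_{d,k}(z)$ and $\theta_{d',k'}(z)$ (with $k,k'\in K$, $d,d'\in K^*$, $k^2\neq d$ and $k'^2\neq d'$) are conjugate over $K$ if and only if $$d'=b^2d\quad\text{and}\quad k'\in\left\{\frac{bd}{k},\ \frac{b\left(d^2\gamma^3+3dk\gamma^2+3d\gamma+k\right)}{dk\gamma^3+3d\gamma^2+3k\gamma+1}\right\}$$ for some $\gamma\in K$ and $b\in K^*$. Each quadratic rational map in $K(z)$ must fall into exactly one of the cases (a) (the multipliers are distinct or exactly two multipliers are $1$), (b) ($\lambda_1=\lambda_2\neq 1$ and $\lambda_3\neq\lambda_1$ for some ordering of the multipliers, or $\lambda_1=\lambda_2=\lambda_3=1$), (c) ($\lambda_1=\lambda_2=\lambda_3=-2$), so this gives a complete description of the $K$-conjugacy classes of such maps.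
   Context: A rational map of degree $d$ over $K$ is $\phi(z)=P(z)/Q(z)$ with $P,Q\in K[z]$ having no common root in $\overline K$ and $\max\{\deg P,\deg Q\}=d$, viewed as a morphism $\mathbb P^1\to\mathbb P^1$; ''quadratic'' means degree $2$. Two rational maps $\phi,\psi$ are conjugate (equivalently, conjugate over $\overline K$) if there is $h\in\mathrm{PGL}_2(\overline K)$ with $\phi^h:=h^{-1}\circ\phi\circ h=\psi$; they are conjugate over $K$ if one can take $h\in\mathrm{PGL}_2(K)$. A degree-$2$ map has $3$ fixed points in $\mathbb P^1(\overline K)$ counted with multiplicity; the multiplicity of a finite fixed point is its multiplicity as a root of $P(z)-zQ(z)$, and the point at infinity is treated by conjugating it to a finite point. The multiplier of a finite fixed point $\alpha$ is $\phi'(\alpha)$; the multiplier at $\infty$ is defined by conjugating $\infty$ to a finite point (multipliers are conjugacy invariant). ''Counted with multiplicity'' means each fixed point's multiplier is listed as many times as the multiplicity of the fixed point. ''Maps of this form'' in (a) means maps obtained from pairs $(\sigma_1,\sigma_2)$ arising from degree-$2$ maps $\psi$ as in (a). The hypotheses on multipliers are understood up to relabeling. In the set describing $k'$ in (c), an expression whose denominator vanishes is not counted as a possible value. *)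

(* Defs.v *)
From HB Require Import structures.
From mathcomp Require Import all_boot all_order all_algebra.

Set Implicit Arguments.
Unset Strict Implicit.
Unset Printing Implicit Defensive.

Import GRing.Theory.
Local Open Scope ring_scope.

Section RationalFunctions.
Variable K : fieldType.
Implicit Types (f g : {fraction {poly K}}) (M : 'M[K]_2).

Definition ratC (c : K) : {fraction {poly K}} := FracField.tofrac c%:P.
Definition ratX : {fraction {poly K}} := FracField.tofrac 'X.

(* [repr f] is an arbitrary, possibly non-reduced, pair representing f;
   dividing by its gcd gives coprime P, Q with f = P / Q. *)
Definition ratnum f : {poly K} :=
  \n_(repr f) %/ gcdp \n_(repr f) \d_(repr f).
Definition ratden f : {poly K} :=
  \d_(repr f) %/ gcdp \n_(repr f) \d_(repr f).

Definition ratdeg f : nat := (maxn (size (ratnum f)) (size (ratden f))).-1.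

(* The composite f o g, as P(g) / Q(g) for f = P / Q.  This is meaningful for
   nonconstant g (Q(g) is then nonzero), the only case used below. *)
Definition ratcomp f g : {fraction {poly K}} :=
  (map_poly ratC (ratnum f)).[g] / (map_poly ratC (ratden f)).[g].

Definition moebius M : {fraction {poly K}} :=
  (ratC (M 0 0) * ratX + ratC (M 0 1)) / (ratC (M 1 0) * ratX + ratC (M 1 1)).

(* f^h = h^-1 o f o h for h = moebius M, with M invertible. *)
Definition ratconj M f : {fraction {poly K}} :=
  ratcomp (moebius (invmx M)) (ratcomp f (moebius M)).

Definition conjugate f g : Prop :=
  exists2 M : 'M[K]_2, M \in unitmx & ratconj M f = g.

(* The matrix of z |-> 1/z, which exchanges 0 and infinity. *)
Definition swap0inf : 'M[K]_2 := \matrix_(i, j) (i != j)%:R.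

(* A point of the projective line is [Some a] for a finite point a, and [None]
   for infinity.  Multiplicity 0 means that the point is not fixed. *)
Definition fin_fixmult f (a : K) : nat := mup a (ratnum f - 'X * ratden f).

Definition fixmult f (x : option K) : nat :=
  if x is Some a then fin_fixmult f a else fin_fixmult (ratconj swap0inf f) 0.

(* The derivative P/Q |-> (P'Q - PQ') / Q^2, evaluated at a finite fixed point
   (where Q does not vanish). *)
Definition fin_multiplier f (a : K) : K :=
  ((ratnum f)^`() * ratden f - ratnum f * (ratden f)^`()).[a]
    / (ratden f).[a] ^+ 2.

Definition multiplier f (x : option K) : K :=
  if x is Some a then fin_multiplier f a
  else fin_multiplier (ratconj swap0inf f) 0.

(* [s] lists, in some order and with multiplicity, the multipliers of the
   K-rational fixed points of f; it is used over algebraically closed K. *)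
Definition fix_multipliers f (s : seq K) : Prop :=
  exists2 pts : seq (option K),
    (forall x, count_mem x pts = fixmult f x)
    & perm_eq s (map (multiplier f) pts).

Definition phiA (s1 s2 : K) : {fraction {poly K}} :=
  (2 * ratX ^+ 2 + ratC (2 - s1) * ratX + ratC (2 - s1))
    / (- ratX ^+ 2 + ratC (2 + s1) * ratX + ratC (2 - s1 - s2)).

Definition phiB (k b : K) : {fraction {poly K}} := ratC k * ratX + ratC b / ratX.

Definition thetaC (d k : K) : {fraction {poly K}} :=
  (ratC k * ratX ^+ 2 - ratC (2 * d) * ratX + ratC (d * k))
    / (ratX ^+ 2 - ratC (2 * k) * ratX + ratC d).

End RationalFunctions.

Definition caseA (L : fieldType) (l1 l2 l3 : L) : Prop :=
  uniq [:: l1; l2; l3] \/ count_mem 1 [:: l1; l2; l3] = 2%N.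

Definition caseB (L : fieldType) (l1 l2 l3 : L) : Prop :=
  [/\ l1 = l2, l2 <> 1 & l3 <> l1] \/ [/\ l1 = 1, l2 = 1 & l3 = 1].

Definition caseC (L : fieldType) (l1 l2 l3 : L) : Prop :=
  [/\ l1 = - 2, l2 = - 2 & l3 = - 2].

Section BaseChange.
Variables (K L : fieldType) (iota : {rmorphism K -> L}).

Definition ratmap (f : {fraction {poly K}}) : {fraction {poly L}} :=
  FracField.tofrac (map_poly iota (ratnum f))
    / FracField.tofrac (map_poly iota (ratden f)).

(* Conjugacy over the extension L of K. *)
Definition conjugate_over (f g : {fraction {poly K}}) : Prop :=
  conjugate (ratmap f) (ratmap g).

(* For L an algebraic closure of K: l1, l2, l3 are the multipliers of the
   fixed points of f, counted with multiplicity, in some order. *)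
Definition multipliers3 (f : {fraction {poly K}}) (l1 l2 l3 : L) : Prop :=
  fix_multipliers (ratmap f) [:: l1; l2; l3].

(* The quantification over l1, l2, l3 ranges over all orderings. *)
Definition in_case (P : L -> L -> L -> Prop) (f : {fraction {poly K}}) : Prop :=
  exists l1 l2 l3 : L, multipliers3 f l1 l2 l3 /\ P l1 l2 l3.

(* s1, s2 are the first two symmetric functions of l1, l2, l3, viewed in K. *)
Definition sym_functions (l1 l2 l3 : L) (s1 s2 : K) : Prop :=
  iota s1 = l1 + l2 + l3 /\ iota s2 = l1 * l2 + l1 * l3 + l2 * l3.

Definition paramA (s1 s2 : K) : Prop :=
  exists (psi : {fraction {poly K}}) (l1 l2 l3 : L),
    [/\ ratdeg psi = 2%N, multipliers3 psi l1 l2 l3, caseA l1 l2 l3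
      & sym_functions l1 l2 l3 s1 s2].

End BaseChange.

Definition paramB (K : fieldType) (k b : K) : Prop :=
  [/\ k <> 0, k <> - (1 / 2) & b <> 0].

Definition paramC (K : fieldType) (d k : K) : Prop := d <> 0 /\ k ^+ 2 <> d.

(* Main.v *)
Require Import Defs.
From HB Require Import structures.
From mathcomp Require Import all_boot all_order all_algebra.
From mathcomp Require Import ring.

Set Implicit Arguments.
Unset Strict Implicit.
Unset Printing Implicit Defensive.

Import GRing.Theory.
Local Open Scope ring_scope.

(** A quadratic map [P : Q] of the projective line is encoded by the binary cubic
    form F = (y P - x Q) / 3, whose zeros are the fixed points, and the linear
    form l = (P_x + Q_y) / 3; conversely P = F_y + l x and Q = - F_x + l y.
    Conjugation by a matrix M becomes (F, l) |-> (F o M, det M * (l o M)).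
    If F is the product of the forms b_i x - a_i y and u_i = (a_i, b_i), the
    multiplier m_i at u_i satisfies (m_i - 1) l(u_i) = (m_i + 2) E_i, where E_i is
    the product of the determinants det(u_i, u_j) over j <> i.  Hence l = 0 exactly
    in case (c), where diagonalising the Hessian of F over K gives the normal form.
    Otherwise l can be moved to y.  Then the cubic covariant of F evaluated at the
    zero of l vanishes exactly in case (b), where translating the fixed points gives
    F = f0 x^3 + f2 x y^2; when it does not vanish, there is a Moebius map over K
    that sends each fixed point to its own multiplier, and it conjugates the map
    to the normal form (a). *)

(** * Reduced fractions *)

(** The fixed points and multipliers live in the closure, while the conjugations must be defined
    over K. So each criterion is the vanishing of l or of a covariant of (F, l), hence a condition
    on coefficients: it is evaluated on the roots of F over the closure, and it descends because
    [iota] is injective. The multiplier is a quadratic expression in the fixed point, but modulo F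
    it becomes a Moebius function of it; the determinant of this function is 3 times the cubic
    covariant, which is why that covariant separates (a) from (b). The symmetric functions of the
    multipliers are ratios of invariants of (F, l), so the parameters in (a) are determined by the
    conjugacy class. Division by 3 is what splits the pair (P, Q) into F and l, which then transform
    independently of each other. *)

Section ReducedFractions.
Variable K : fieldType.
Implicit Types (f g : {fraction {poly K}}) (P Q : {poly K}).

Local Notation "p %:F" := (FracField.tofrac p).
Local Notation ratpoly := (map_poly (@ratC K)).

Lemma frac_reprE f : f = (\n_(repr f))%:F / (\d_(repr f))%:F.
Proof.
have d0 := denom_ratioP (repr f).
rewrite -{1}[f]reprK; unlock FracField.tofrac.
rewrite !piE; apply/eqP; rewrite piE /FracField.equivf /=.
by rewrite /FracField.mulf /FracField.invf !numden_Ratio ?oner_neq0 ?mul1r ?mulr1 1?mulrC.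
Qed.

Lemma coprime_ratnum_ratden f : coprimep (ratnum f) (ratden f).
Proof. by apply: coprimep_div_gcd; rewrite denom_ratioP orbT. Qed.

Lemma ratden_neq0 f : ratden f != 0.
Proof.
have d0 := denom_ratioP (repr f).
by rewrite /ratden dvdp_div_eq0 ?dvdp_gcdr.
Qed.

Lemma ratnum_ratden f : f = (ratnum f)%:F / (ratden f)%:F.
Proof.
have d0 := denom_ratioP (repr f).
have g0 : gcdp \n_(repr f) \d_(repr f) != 0 by rewrite gcdp_eq0 negb_and d0 orbT.
rewrite {1}[f]frac_reprE /ratnum /ratden.
rewrite -{1}(divpK (dvdp_gcdl \n_(repr f) \d_(repr f))).
rewrite -{3}(divpK (dvdp_gcdr \n_(repr f) \d_(repr f))).
rewrite !tofracM invfM mulrACA divff ?mulr1 // tofrac_eq0 //.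
Qed.

Lemma coprime_proportional (P Q P' Q' : {poly K}) :
  Q != 0 -> Q' != 0 -> coprimep P Q -> coprimep P' Q' -> P * Q' = P' * Q ->
  exists2 c : K, c != 0 & P' = c *: P /\ Q' = c *: Q.
Proof.
move=> Q0 Q'0 cPQ cPQ' E.
have h : Q %= Q'.
  apply/andP; split.
    rewrite -(@Gauss_dvdpr _ Q' P Q) ?(coprimep_sym Q P) // E.
    exact: dvdp_mulIr.
  rewrite -(@Gauss_dvdpr _ Q P' Q') ?(coprimep_sym Q' P') // -E.
  exact: dvdp_mulIr.
have /eqpf_eq [c c0 Ec] : Q' %= Q by rewrite eqp_sym.
exists c => //; split=> //.
by apply: (mulIf Q0); rewrite -E Ec -scalerAr -scalerAl.
Qed.

(** [ratnum] and [ratden] come from an arbitrary representative, so they are known only up to a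
    common constant. Later computations start from a convenient reduced pair and cancel c. *)
Lemma ratnum_ratdenE (P Q : {poly K}) : Q != 0 -> coprimep P Q ->
  exists2 c : K, c != 0 &
    ratnum (P%:F / Q%:F) = c *: P /\ ratden (P%:F / Q%:F) = c *: Q.
Proof.
move=> Q0 cPQ; set f := _ / _.
apply: coprime_proportional => //.
- exact: ratden_neq0.
- exact: coprime_ratnum_ratden.
apply/eqP; rewrite -tofrac_eq !tofracM -eqr_div ?tofrac_eq0 ?ratden_neq0 //.
by rewrite -ratnum_ratden.
Qed.

Lemma map_ratCE P : ratpoly P = map_poly (@FracField.tofrac {poly K} \o polyC) P.
Proof. exact: eq_map_poly. Qed.

Lemma ratcompE (P Q : {poly K}) g : Q != 0 -> coprimep P Q ->
  ratcomp (P%:F / Q%:F) g = (ratpoly P).[g] / (ratpoly Q).[g].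
Proof.
move=> Q0 cPQ; have [c c0 [En Ed]] := ratnum_ratdenE Q0 cPQ.
rewrite /ratcomp En Ed !map_ratCE !map_polyZ !hornerZ invfM mulrACA divff ?mul1r //.
by rewrite /= tofrac_eq0 polyC_eq0.
Qed.

End ReducedFractions.

(** * Binary quadratic forms and their resultant *)

Section QuadraticPolynomials.
Variable F : fieldType.
Implicit Types a b c p q : F.

Definition quad a b c : {poly F} := a%:P * 'X^2 + b%:P * 'X + c%:P.

(* Resultant of two forms of degree 2, also when a leading coefficient vanishes. *)
Definition resq p2 p1 p0 q2 q1 q0 : F :=
  (p2 * q0 - p0 * q2) ^+ 2 - (p2 * q1 - p1 * q2) * (p1 * q0 - p0 * q1).

Lemma coef_quad a b c i : (quad a b c)`_i = if i is i'.+1 then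
  (if i' is i''.+1 then (if i'' is 0 then a else 0) else b) else c.
Proof.
rewrite /quad !coefD !coefCM coefXn coefX coefC.
by case: i => [|[|[|i]]] /=; rewrite ?mulr0 ?mulr1 ?addr0 ?add0r.
Qed.

Lemma quad_coef (p : {poly F}) : (size p <= 3)%N -> p = quad p`_2 p`_1 p`_0.
Proof.
move=> /leq_sizeP sp; apply/polyP => -[|[|[|i]]]; rewrite coef_quad //.
exact: sp.
Qed.

Lemma horner_quad a b c x : (quad a b c).[x] = a * x ^+ 2 + b * x + c.
Proof. by rewrite /quad !(hornerD, hornerXn, hornerX, hornerC, hornerM). Qed.

Lemma quad_eq0 a b c : (quad a b c == 0) = [&& a == 0, b == 0 & c == 0].
Proof.
apply/eqP/and3P => [h|[/eqP-> /eqP-> /eqP->]]; last by rewrite /quad !mul0r !addr0.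
have h' i : (quad a b c)`_i = 0 by rewrite h coef0.
by split; apply/eqP; [have := h' 2%N|have := h' 1%N|have := h' 0%N]; rewrite coef_quad.
Qed.

Lemma resq_quad_neq0 p2 p1 p0 q2 q1 q0 :
  resq p2 p1 p0 q2 q1 q0 != 0 -> quad q2 q1 q0 != 0.
Proof.
apply: contra; rewrite quad_eq0 => /and3P[/eqP-> /eqP-> /eqP->].
by apply/eqP; rewrite /resq; ring.
Qed.

Lemma resq_coprime p2 p1 p0 q2 q1 q0 :
  resq p2 p1 p0 q2 q1 q0 != 0 -> coprimep (quad p2 p1 p0) (quad q2 q1 q0).
Proof.
move=> R0; apply/Bezout_coprimepP.
pose A1 := p2 * q1 - p1 * q2; pose A0 := p2 * q0 - p0 * q2.
(* Eliminating the leading coefficients gives p2 Q - q2 P = A1 X + A0; eliminating the constants and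
   dividing by X gives - A0 X - (p1 q0 - p0 q1). Adding A0 times the first to A1 times the second
   cancels X and leaves the resultant. *)
exists ((q2 * A1)%:P * 'X + (A1 * q1 - A0 * q2)%:P,
        (- p2 * A1)%:P * 'X + (p2 * A0 - p1 * A1)%:P) => /=.
set e := (X in X %= 1); have -> : e = (resq p2 p1 p0 q2 q1 q0)%:P.
  by rewrite /e /quad /resq /A1 /A0; ring.
by rewrite polyC_eqp1.
Qed.

Lemma resq_sym p2 p1 p0 q2 q1 q0 :
  resq p2 p1 p0 q2 q1 q0 = resq q2 q1 q0 p2 p1 p0.
Proof. by rewrite /resq; ring. Qed.

(** Let A1 X + A0 be the remainder of p2 Q modulo P. If it is zero, P divides Q; if A1 is nonzero,
    its root z = - A0 / A1 lies in F and A1^2 P(z) = p2 times the resultant, so a vanishing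
    resultant yields a common root without extending the field. *)
Lemma coprime_resq_lead p2 p1 p0 q2 q1 q0 : p2 != 0 ->
  coprimep (quad p2 p1 p0) (quad q2 q1 q0) -> resq p2 p1 p0 q2 q1 q0 != 0.
Proof.
move=> p20 cPQ; apply/negP => /eqP R0.
set P := quad p2 p1 p0 in cPQ *; set Q := quad q2 q1 q0 in cPQ *.
pose A1 := p2 * q1 - p1 * q2; pose A0 := p2 * q0 - p0 * q2.
have EA : p2%:P * Q = q2%:P * P + (A1%:P * 'X + A0%:P).
  by rewrite /P /Q /quad /A1 /A0; ring.
have E2 : p2 * A0 ^+ 2 - p1 * A0 * A1 + p0 * A1 ^+ 2 = 0.
  have -> : p2 * A0 ^+ 2 - p1 * A0 * A1 + p0 * A1 ^+ 2
            = p2 * resq p2 p1 p0 q2 q1 q0 by rewrite /resq /A1 /A0; ring.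
  by rewrite R0 mulr0.
have [A10|A10] := eqVneq A1 0.
  have A00 : A0 = 0.
    move: E2; rewrite A10 => E2; apply/eqP; move/eqP: E2.
    by rewrite mulr0 expr0n mulr0 subr0 addr0 mulf_eq0 (negPf p20) sqrf_eq0.
  move: EA; rewrite A10 A00 mul0r !addr0 => EA.
  have PQ : P %| Q by rewrite -(@dvdpZr _ p2) // -mul_polyC EA dvdp_mulIr.
  have : size P == 1%N by move: cPQ; rewrite coprimep_def (eqp_size (dvdp_gcd_idl PQ)).
  move=> /eqP sP; have := coef_quad p2 p1 p0 2; rewrite -/P nth_default ?sP //.
  by move=> h; rewrite -h eqxx in p20.
pose z := - A0 / A1.
have Pz : root P z.
  rewrite /root horner_quad; apply/eqP.
  have -> : p2 * z ^+ 2 + p1 * z + p0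
          = (p2 * A0 ^+ 2 - p1 * A0 * A1 + p0 * A1 ^+ 2) / A1 ^+ 2.
    by rewrite /z; field.
  by rewrite E2 mul0r.
have Qz : root Q z.
  have : root (p2%:P * Q) z.
    rewrite /root EA hornerD hornerM (eqP Pz) mulr0 add0r hornerD hornerM !hornerC hornerX.
    apply/eqP; rewrite /z.
    by field.
  by rewrite rootM rootC (negPf p20).
by have := coprimep_root cPQ Pz; rewrite (eqP Qz) eqxx.
Qed.

(** If both leading coefficients vanished, the forms would share the point at infinity, which
    coprimality of polynomials does not see. *)
Lemma coprime_resq p2 p1 p0 q2 q1 q0 : (p2 != 0) || (q2 != 0) ->
  coprimep (quad p2 p1 p0) (quad q2 q1 q0) -> resq p2 p1 p0 q2 q1 q0 != 0.
Proof.
case/orP => h; first exact: coprime_resq_lead.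
by rewrite coprimep_sym resq_sym; apply: coprime_resq_lead.
Qed.

End QuadraticPolynomials.

(** * Cubic and linear forms encoding a quadratic map *)

(* The cubic form c30 x^3 + c21 x^2 y + c12 x y^2 + c03 y^3, together with the
   linear form c10 x + c01 y. *)
Record cform (F : Type) := CForm { c30 : F; c21 : F; c12 : F; c03 : F; c10 : F; c01 : F }.

Section CubicLinearForms.
Variable F : fieldType.
Implicit Types (d : cform F).

Definition qnum d : {poly F} :=
  quad (c21 d + c10 d) (2 * c12 d + c01 d) (3 * c03 d).
Definition qden d : {poly F} :=
  quad (- 3 * c30 d) (c10 d - 2 * c21 d) (c01 d - c12 d).
Definition qmap d : {fraction {poly F}} :=
  FracField.tofrac (qnum d) / FracField.tofrac (qden d).

(* The cubic form, resp. its Hessian in [inv22], at the zero (c01, - c10) of the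
   linear form. *)
Definition inv13 d : F :=
  c30 d * c01 d ^+ 3 - c21 d * c01 d ^+ 2 * c10 d + c12 d * c01 d * c10 d ^+ 2
  - c03 d * c10 d ^+ 3.
Definition hess0 d : F := c21 d ^+ 2 - 3 * c30 d * c12 d.
Definition hess1 d : F := c21 d * c12 d - 9 * c30 d * c03 d.
Definition hess2 d : F := c12 d ^+ 2 - 3 * c21 d * c03 d.
Definition inv22 d : F :=
  hess0 d * c01 d ^+ 2 - hess1 d * c01 d * c10 d + hess2 d * c10 d ^+ 2.
Definition disc d : F :=
  c21 d ^+ 2 * c12 d ^+ 2 - 4 * c30 d * c12 d ^+ 3 - 4 * c21 d ^+ 3 * c03 d
  + 18 * c30 d * c21 d * c12 d * c03 d - 27 * c30 d ^+ 2 * c03 d ^+ 2.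
(* The resultant of the two quadratic forms, up to a factor -3: see [resq_res]. *)
Definition res d : F := inv13 d - inv22 d + disc d.

Definition cscale t d :=
  CForm (t * c30 d) (t * c21 d) (t * c12 d) (t * c03 d) (t * c10 d) (t * c01 d).

(* The action of the matrix (a b; c e), whose determinant twists the linear form. *)
Definition act a b c e d :=
  let: CForm f0 f1 f2 f3 g0 g1 := d in
  CForm (f0 * a ^+ 3 + f1 * a ^+ 2 * c + f2 * a * c ^+ 2 + f3 * c ^+ 3)
    (3 * f0 * a ^+ 2 * b + f1 * (a ^+ 2 * e + 2 * a * b * c)
      + f2 * (2 * a * c * e + b * c ^+ 2) + 3 * f3 * c ^+ 2 * e)
    (3 * f0 * a * b ^+ 2 + f1 * (2 * a * b * e + b ^+ 2 * c)
      + f2 * (a * e ^+ 2 + 2 * b * c * e) + 3 * f3 * c * e ^+ 2)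
    (f0 * b ^+ 3 + f1 * b ^+ 2 * e + f2 * b * e ^+ 2 + f3 * e ^+ 3)
    ((a * e - b * c) * (g0 * a + g1 * c)) ((a * e - b * c) * (g0 * b + g1 * e)).

Lemma resq_res d :
  resq (c21 d + c10 d) (2 * c12 d + c01 d) (3 * c03 d)
       (- 3 * c30 d) (c10 d - 2 * c21 d) (c01 d - c12 d) = - 3 * res d.
Proof.
by case: d => *; rewrite /resq /res /inv13 /inv22 /disc /hess0 /hess1 /hess2 /=; ring.
Qed.

Lemma inv13_act a b c e d : inv13 (act a b c e d) = (a * e - b * c) ^+ 6 * inv13 d.
Proof. by case: d => *; rewrite /inv13 /=; ring. Qed.

Lemma hess0_act a b c e d : hess0 (act a b c e d) = (a * e - b * c) ^+ 2 *
  (hess0 d * a ^+ 2 + hess1 d * a * c + hess2 d * c ^+ 2).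
Proof. by case: d => *; rewrite /hess0 /hess1 /hess2 /=; ring. Qed.

Lemma hess1_act a b c e d : hess1 (act a b c e d) = (a * e - b * c) ^+ 2 *
  (2 * hess0 d * a * b + hess1 d * (a * e + b * c) + 2 * hess2 d * c * e).
Proof. by case: d => *; rewrite /hess0 /hess1 /hess2 /=; ring. Qed.

Lemma hess2_act a b c e d : hess2 (act a b c e d) = (a * e - b * c) ^+ 2 *
  (hess0 d * b ^+ 2 + hess1 d * b * e + hess2 d * e ^+ 2).
Proof. by case: d => *; rewrite /hess0 /hess1 /hess2 /=; ring. Qed.

Lemma inv22_act a b c e d : inv22 (act a b c e d) = (a * e - b * c) ^+ 6 * inv22 d.
Proof.
rewrite /inv22 hess0_act hess1_act hess2_act.
by move: (hess0 d) (hess1 d) (hess2 d); case: d => * /=; ring.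
Qed.

Lemma disc_hess d : 3 * disc d = 4 * hess0 d * hess2 d - hess1 d ^+ 2.
Proof. by rewrite /disc /hess0 /hess1 /hess2; ring. Qed.

Lemma disc_act a b c e d : disc (act a b c e d) = (a * e - b * c) ^+ 6 * disc d.
Proof. by case: d => *; rewrite /disc /=; ring. Qed.

Lemma res_act a b c e d : res (act a b c e d) = (a * e - b * c) ^+ 6 * res d.
Proof. by rewrite /res inv13_act inv22_act disc_act; ring. Qed.

Lemma act_act a b c e a' b' c' e' d :
  act a b c e (act a' b' c' e' d) =
  act (a' * a + b' * c) (a' * b + b' * e) (c' * a + e' * c) (c' * b + e' * e) d.
Proof. by case: d => * /=; f_equal; ring. Qed.

End CubicLinearForms.

Lemma homogenize_quad (L : fieldType) (u v w n m : L) : m != 0 ->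
  u * (n / m) ^+ 2 + v * (n / m) + w
  = (u * (n * n) + v * n * m + w * (m * m)) / m ^+ 2.
Proof. by move=> m0; field. Qed.

Lemma quad_subst (L : fieldType) (p2 p1 p0 a b c e : L) :
  p2%:P * quad 0 a b ^+ 2 + p1%:P * quad 0 a b * quad 0 c e
    + p0%:P * quad 0 c e ^+ 2
  = quad (p2 * a ^+ 2 + p1 * a * c + p0 * c ^+ 2)
         (2 * p2 * a * b + p1 * (a * e + b * c) + 2 * p0 * c * e)
         (p2 * b ^+ 2 + p1 * b * e + p0 * e ^+ 2).
Proof. by rewrite /quad; ring. Qed.

Lemma resq_subst (L : fieldType) (p2 p1 p0 q2 q1 q0 a b c e : L) :
  resq (p2 * a ^+ 2 + p1 * a * c + p0 * c ^+ 2)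
       (2 * p2 * a * b + p1 * (a * e + b * c) + 2 * p0 * c * e)
       (p2 * b ^+ 2 + p1 * b * e + p0 * e ^+ 2)
       (q2 * a ^+ 2 + q1 * a * c + q0 * c ^+ 2)
       (2 * q2 * a * b + q1 * (a * e + b * c) + 2 * q0 * c * e)
       (q2 * b ^+ 2 + q1 * b * e + q0 * e ^+ 2)
  = (a * e - b * c) ^+ 4 * resq p2 p1 p0 q2 q1 q0.
Proof. by rewrite /resq; ring. Qed.

Lemma quad_subst_neq0 (L : fieldType) (p2 p1 p0 q2 q1 q0 a b c e : L) :
  a * e - b * c != 0 -> resq p2 p1 p0 q2 q1 q0 != 0 ->
  quad (q2 * a ^+ 2 + q1 * a * c + q0 * c ^+ 2)
       (2 * q2 * a * b + q1 * (a * e + b * c) + 2 * q0 * c * e)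
       (q2 * b ^+ 2 + q1 * b * e + q0 * e ^+ 2) != 0.
Proof.
move=> det0 r0; have := resq_subst p2 p1 p0 q2 q1 q0 a b c e.
set r := (RHS) => E; have r'0 : r != 0 by rewrite mulf_neq0 // expf_neq0.
by rewrite -E in r'0; apply: resq_quad_neq0 r'0.
Qed.

(** * Rational maps attached to forms: equality and conjugation *)

Section QuadraticMaps.
Variable K : fieldType.
Hypothesis char3 : (3 : K) != 0.
Implicit Types (d : cform K) (M : 'M[K]_2).

Local Notation "p %:F" := (FracField.tofrac p).

HB.instance Definition _ := GRing.RMorphism.copy (@ratC K)
  (@FracField.tofrac {poly K} \o polyC).

Lemma ratC_eq0 c : (ratC c == 0 :> {fraction {poly K}}) = (c == 0).
Proof. by rewrite tofrac_eq0 polyC_eq0. Qed.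

Lemma tofrac_quad (a b c : K) :
  (quad a b c)%:F = ratC a * ratX K ^+ 2 + ratC b * ratX K + ratC c.
Proof. by rewrite /quad !tofracD !tofracM. Qed.

Lemma res_resq d : res d != 0 ->
  resq (c21 d + c10 d) (2 * c12 d + c01 d) (3 * c03 d)
       (- 3 * c30 d) (c10 d - 2 * c21 d) (c01 d - c12 d) != 0.
Proof. by move=> d0; rewrite resq_res mulf_neq0 // oppr_eq0. Qed.

Lemma qden_neq0 d : res d != 0 -> qden d != 0.
Proof. by move=> /res_resq/resq_quad_neq0. Qed.

Lemma coprime_qnum_qden d : res d != 0 -> coprimep (qnum d) (qden d).
Proof. by move=> /res_resq/resq_coprime. Qed.

Lemma qmap_scale t d : t != 0 -> qmap (cscale t d) = qmap d.
Proof.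
move=> t0; rewrite /qmap.
have -> : qnum (cscale t d) = t%:P * qnum d by rewrite /qnum /quad /=; ring.
have -> : qden (cscale t d) = t%:P * qden d by rewrite /qden /quad /=; ring.
by rewrite !tofracM invfM mulrACA divff ?mul1r // tofrac_eq0 polyC_eq0.
Qed.

Lemma quad_inj (a b c a' b' c' : K) :
  quad a b c = quad a' b' c' -> [/\ a = a', b = b' & c = c'].
Proof.
move=> h; have h' i := congr1 (fun p : {poly K} => p`_i) h.
by split; [have := h' 2%N|have := h' 1%N|have := h' 0%N]; rewrite /= !coef_quad.
Qed.

(** Reducedness fixes (P, Q) up to t. The coefficients of 3 F and 3 l are integral combinations of
    those of P and Q, and 3 can be cancelled. *)
Lemma qmap_inj d d' : res d != 0 -> res d' != 0 -> qmap d = qmap d' ->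
  exists2 t : K, t != 0 & d' = cscale t d.
Proof.
move=> d0 d'0 E.
have [c c0 [En Ed]] : exists2 c : K, c != 0 & qnum d' = c *: qnum d /\ qden d' = c *: qden d.
  apply: coprime_proportional; rewrite ?qden_neq0 ?coprime_qnum_qden //.
  apply/eqP; rewrite -tofrac_eq !tofracM -eqr_div ?tofrac_eq0 ?qden_neq0 //.
  exact/eqP.
exists c => //; move: En Ed; rewrite -!mul_polyC.
have -> : c%:P * qnum d = qnum (cscale c d) by rewrite /qnum /quad /=; ring.
have -> : c%:P * qden d = qden (cscale c d) by rewrite /qden /quad /=; ring.
move=> /quad_inj [n2 n1 n0] /quad_inj [m2 m1 m0].
case: d d' {E d0 d'0} n2 n1 n0 m2 m1 m0 => [f0 f1 f2 f3 g0 g1] [f0' f1' f2' f3' g0' g1'] /=.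
move=> n2 n1 n0 m2 m1 m0.
have h3 (x y : K) : 3 * x = 3 * y -> x = y by apply: (mulfI char3).
congr CForm; apply: h3 => /=.
- by apply: oppr_inj; rewrite -!mulNr.
- transitivity ((f1' + g0') - (g0' - 2 * f1')); first by ring.
  by rewrite n2 m1; ring.
- transitivity ((2 * f2' + g1') - (g1' - f2')); first by ring.
  by rewrite n1 m0; ring.
- by [].
- transitivity (2 * (f1' + g0') + (g0' - 2 * f1')); first by ring.
  by rewrite n2 m1; ring.
- transitivity ((2 * f2' + g1') + 2 * (g1' - f2')); first by ring.
  by rewrite n1 m0; ring.
Qed.

Lemma det_mx22 M : \det M = M 0 0 * M 1 1 - M 0 1 * M 1 0.
Proof.
rewrite (expand_det_row _ 0) !big_ord_recl big_ord0 addr0 /cofactor !det_mx11 !mxE /=.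
rewrite !expr0 !expr1 !mul1r mulN1r mulrN.
by congr (_ * M _ _ - M _ _ * M _ _); apply: val_inj.
Qed.

Lemma unitmx2 M : (M \in unitmx) = (M 0 0 * M 1 1 - M 0 1 * M 1 0 != 0).
Proof. by rewrite unitmxE unitfE det_mx22. Qed.

Lemma map_quad (L : fieldType) (f : {rmorphism K -> L}) (a b c : K) :
  map_poly f (quad a b c) = quad (f a) (f b) (f c).
Proof.
by rewrite /quad 2!rmorphD 2!rmorphM rmorphXn /= !map_polyC map_polyX.
Qed.

Definition mx22 (a b c e : K) : 'M[K]_2 :=
  \matrix_(i, j) if i == 0 then if j == 0 then a else b
                 else if j == 0 then c else e.

Lemma invmx2 M : M \in unitmx ->
  let D := M 0 0 * M 1 1 - M 0 1 * M 1 0 in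
  invmx M = mx22 (M 1 1 / D) (- M 0 1 / D) (- M 1 0 / D) (M 0 0 / D).
Proof.
move=> Mu D; have D0 : D != 0 by rewrite -unitmx2.
set N := mx22 _ _ _ _; rewrite -[RHS](mulKmx Mu).
have -> : M *m N = 1%:M; last by rewrite mulmx1.
apply/matrixP => i j; rewrite !mxE !big_ord_recl big_ord0 !mxE.
have -> : lift ord0 ord0 = 1 :> 'I_2 by apply: val_inj.
have [->|->] : i = 0 \/ i = 1.
  by case: i => [[|[|//]] i]; [left|right]; apply: val_inj.
all: have [->|->] : j = 0 \/ j = 1 by
  case: j => [[|[|//]] j]; [left|right]; apply: val_inj.
all: by rewrite /= /D; field.
Qed.

Lemma moebius_inv M : M \in unitmx -> moebius (invmx M) =
  (quad 0 (M 1 1) (- M 0 1))%:F / (quad 0 (- M 1 0) (M 0 0))%:F.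
Proof.
move=> Mu; rewrite invmx2 // /moebius !mxE /=.
set D := _ - _; have D0 : D != 0 by rewrite -unitmx2.
rewrite !tofrac_quad !rmorph0 !mul0r !add0r.
have C0 : ratC D^-1 != 0 :> {fraction {poly K}} by rewrite ratC_eq0 invr_eq0.
rewrite !rmorphM /=.
rewrite -[RHS](mulr1) -(divff C0) mulrACA -invfM.
by congr (_ / _); rewrite mulrDl mulrAC.
Qed.

Lemma ratcomp_quad (p2 p1 p0 q2 q1 q0 : K) (N D : {poly K}) :
  quad q2 q1 q0 != 0 -> coprimep (quad p2 p1 p0) (quad q2 q1 q0) -> D != 0 ->
  ratcomp ((quad p2 p1 p0)%:F / (quad q2 q1 q0)%:F) (N%:F / D%:F)
  = (p2%:P * N ^+ 2 + p1%:P * N * D + p0%:P * D ^+ 2)%:F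
    / (q2%:P * N ^+ 2 + q1%:P * N * D + q0%:P * D ^+ 2)%:F.
Proof.
move=> q_neq0 cpq D0; have D0' : D%:F != 0 by rewrite tofrac_eq0.
rewrite ratcompE //.
have E u v w : (map_poly (@ratC K) (quad u v w)).[N%:F / D%:F] =
    (u%:P * N ^+ 2 + v%:P * N * D + w%:P * D ^+ 2)%:F / D%:F ^+ 2.
  rewrite map_quad horner_quad /ratC !tofracD !tofracM.
  exact: homogenize_quad.
have D2 : D%:F ^+ 2 != 0 by rewrite expf_neq0.
by rewrite !E invf_div mulrA mulfVK.
Qed.

Lemma quad0_neq0 (a b c e : K) : a * e - b * c != 0 -> quad 0 c e != 0.
Proof.
rewrite quad_eq0 eqxx /=; apply: contra => /andP[/eqP-> /eqP->].
by rewrite !mulr0 subr0.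
Qed.

Lemma coprime_quad0 (a b c e : K) :
  a * e - b * c != 0 -> coprimep (quad 0 a b) (quad 0 c e).
Proof.
move=> det0; apply/Bezout_coprimepP; exists ((- c)%:P, a%:P) => /=.
have -> : (- c)%:P * quad 0 a b + a%:P * quad 0 c e = (a * e - b * c)%:P.
  by rewrite /quad; ring.
by rewrite polyC_eqp1.
Qed.

Lemma ratcomp_linear (a b c e : K) (N D : {poly K}) :
  a * e - b * c != 0 -> D != 0 ->
  ratcomp ((quad 0 a b)%:F / (quad 0 c e)%:F) (N%:F / D%:F)
  = (a%:P * N + b%:P * D)%:F / (c%:P * N + e%:P * D)%:F.
Proof.
move=> det0 D0; rewrite ratcomp_quad ?(quad0_neq0 det0) ?coprime_quad0 //.
rewrite !mul0r !add0r.
(* A map of degree 1 is treated here as a pair of quadratic forms without leading term, which leaves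
   a surplus factor D on both sides. *)
have E u v : u%:P * N * D + v%:P * D ^+ 2 = D * (u%:P * N + v%:P * D) by ring.
rewrite !E !tofracM invfM mulrACA divff ?mul1r //; by rewrite tofrac_eq0.
Qed.

(** Conjugation replaces (P, Q) by the adjugate of M applied to (P o M, Q o M). With (X, Y) = M (x,
    y), the new y P - x Q is Y P(X, Y) - X Q(X, Y), so F becomes F o M with no determinant
    factor. *)
Lemma ratconj_qmap M d : M \in unitmx -> res d != 0 ->
  ratconj M (qmap d) = qmap (act (M 0 0) (M 0 1) (M 1 0) (M 1 1) d).
Proof.
move=> Mu d0; have det0 := Mu; rewrite unitmx2 in det0.
move: det0; rewrite /ratconj (moebius_inv Mu).
have -> : moebius M = (quad 0 (M 0 0) (M 0 1))%:F / (quad 0 (M 1 0) (M 1 1))%:F.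
  by rewrite /moebius !tofrac_quad !rmorph0 !mul0r !add0r.
move: (M 0 0) (M 0 1) (M 1 0) (M 1 1) => a b c e det0.
have r0 := res_resq d0.
have det0' : e * a - - b * - c != 0 by rewrite mulrNN mulrC.
rewrite {1}/qmap {1}/qnum {1}/qden ratcomp_quad ?(quad0_neq0 det0) //; last first.
- exact: resq_coprime.
- exact: resq_quad_neq0 r0.
rewrite !quad_subst ratcomp_linear //; last first.
  exact: quad_subst_neq0 r0.
rewrite /qmap; congr (_%:F / _%:F).
  by case: (d) => *; rewrite /qnum /quad /=; ring.
by case: (d) => *; rewrite /qden /quad /=; ring.
Qed.

End QuadraticMaps.

Definition cmap (F L : Type) (f : F -> L) (d : cform F) : cform L :=
  CForm (f (c30 d)) (f (c21 d)) (f (c12 d)) (f (c03 d)) (f (c10 d)) (f (c01 d)).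

(** * Equivalence of forms and conjugacy of maps *)

Section Equivalence.
Variable K : fieldType.
Implicit Types (d : cform K) (M : 'M[K]_2).

(** The scalar t reflects that a fraction determines its form only up to a nonzero constant. *)
Definition cequiv d d' := exists a b c e t : K,
  [/\ a * e - b * c != 0, t != 0 & act a b c e d = cscale t d'].

Lemma cscale_cscale s t d : cscale s (cscale t d) = cscale (s * t) d.
Proof. by rewrite /cscale /= !mulrA. Qed.

Lemma cscale1 d : cscale 1 d = d.
Proof. by case: d => *; rewrite /cscale /= !mul1r. Qed.

Lemma act_cscale t a b c e d : act a b c e (cscale t d) = cscale t (act a b c e d).
Proof. by case: d => *; rewrite /cscale /=; f_equal; ring. Qed.

Lemma act_scalar a d : act a 0 0 a d = cscale (a ^+ 3) d.
Proof. by case: d => *; rewrite /cscale /=; f_equal; ring. Qed.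

Lemma res_cscale t d : res (cscale t d) = t ^+ 4 * res d.
Proof. by case: d => *; rewrite /res /inv13 /inv22 /hess0 /hess1 /hess2 /disc /=; ring. Qed.

Lemma cequiv_sym d d' : cequiv d d' -> cequiv d' d.
Proof.
case=> [a [b [c [e [t [D0 t0 E]]]]]].
(* The adjugate is used instead of the inverse: its product with the matrix is the scalar matrix of
   the determinant, which acts by the cube of that scalar. *)
exists e, (- b), (- c), a, ((a * e - b * c) ^+ 3 / t); split.
- by rewrite mulrNN mulrC.
- by rewrite mulf_neq0 ?invr_eq0 // expf_neq0.
have -> : d' = cscale t^-1 (act a b c e d) by rewrite E cscale_cscale mulVf // cscale1.
rewrite act_cscale act_act; have -> : a * - b + b * a = 0 by ring.
have -> : c * e + e * - c = 0 by ring.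
have -> : a * e + b * - c = a * e - b * c by ring.
have -> : c * - b + e * a = a * e - b * c by ring.
by rewrite act_scalar cscale_cscale mulrC.
Qed.

Lemma cequiv_trans d2 d1 d3 : cequiv d1 d2 -> cequiv d2 d3 -> cequiv d1 d3.
Proof.
case=> [a [b [c [e [t [D0 t0 E]]]]]] [a' [b' [c' [e' [t' [D0' t0' E']]]]]].
exists (a * a' + b * c'), (a * b' + b * e'), (c * a' + e * c'), (c * b' + e * e'), (t * t').
split; last by rewrite -act_act E act_cscale E' cscale_cscale.
  suff -> : (a * a' + b * c') * (c * b' + e * e')
            - (a * b' + b * e') * (c * a' + e * c')
            = (a * e - b * c) * (a' * e' - b' * c') by rewrite mulf_neq0.
  by ring.
by rewrite mulf_neq0.
Qed.

Lemma cequiv_res d d' : cequiv d d' -> res d != 0 -> res d' != 0.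
Proof.
case=> [a [b [c [e [t [D0 t0 E]]]]]] d0.
have : res (act a b c e d) != 0 by rewrite res_act mulf_neq0 // expf_neq0.
by rewrite E res_cscale mulf_eq0 negb_or => /andP[].
Qed.

Hypothesis char3 : (3 : K) != 0.

Lemma cequiv_conjugate d d' : res d != 0 -> cequiv d d' -> conjugate (qmap d) (qmap d').
Proof.
move=> d0 [a [b [c [e [t [D0 t0 E]]]]]].
have Mu : mx22 a b c e \in unitmx by rewrite unitmx2 !mxE.
exists (mx22 a b c e) => //.
by rewrite ratconj_qmap // !mxE /= E qmap_scale.
Qed.

Lemma conjugate_cequiv d d' : res d != 0 -> res d' != 0 ->
  conjugate (qmap d) (qmap d') -> cequiv d d'.
Proof.
move=> d0 d'0 [M Mu]; rewrite ratconj_qmap // => E.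
have D0 := Mu; rewrite unitmx2 in D0.
have [|t t0 E'] := qmap_inj char3 d'0 _ (esym E).
  by rewrite res_act mulf_neq0 // expf_neq0.
by exists (M 0 0), (M 0 1), (M 1 0), (M 1 1), t.
Qed.

Lemma ratdeg2_qmap (f : {fraction {poly K}}) : ratdeg f = 2%N ->
  exists2 d, res d != 0 & f = qmap d.
Proof.
rewrite /ratdeg => sPQ.
have : maxn (size (ratnum f)) (size (ratden f)) = 3%N by case: maxn sPQ => // n /= ->.
move: sPQ => _.
have := coprime_ratnum_ratden f; have := ratnum_ratden f.
move: (ratnum f) (ratden f) => P Q fE cPQ sPQ; rewrite {f}fE.
have sP : (size P <= 3)%N by have := leq_maxl (size P) (size Q); rewrite sPQ.
have sQ : (size Q <= 3)%N by have := leq_maxr (size P) (size Q); rewrite sPQ.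
have lead : (P`_2 != 0) || (Q`_2 != 0).
  have [s|s] : size P = 3%N \/ size Q = 3%N by move: sPQ; rewrite /maxn; case: ltnP; auto.
    by rewrite -[2%N]/(3.-1) -{1}s -lead_coefE lead_coef_eq0 -size_poly_eq0 s.
  by rewrite orbC -[2%N]/(3.-1) -{1}s -lead_coefE lead_coef_eq0 -size_poly_eq0 s.
move: cPQ; rewrite (quad_coef sP) (quad_coef sQ).
move: (P`_2) (P`_1) (P`_0) (Q`_2) (Q`_1) (Q`_0) lead => p2 p1 p0 q2 q1 q0 lead cPQ.
have r0 := coprime_resq lead cPQ.
pose d := CForm (- q2 / 3) ((p2 - q1) / 3) ((p1 - q0) / 3) (p0 / 3)
                ((2 * p2 + q1) / 3) ((p1 + 2 * q0) / 3).
have [En Ed] : qnum d = quad p2 p1 p0 /\ qden d = quad q2 q1 q0.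
  by split; rewrite /qnum /qden /=; congr quad; field.
exists d; last by rewrite /qmap En Ed.
have := resq_res d; move: En Ed => /quad_inj[-> -> ->] /quad_inj[-> -> ->] E.
by move: r0; rewrite E mulf_eq0 negb_or => /andP[].
Qed.

End Equivalence.

(** * Extension of scalars *)

Section CformBaseChange.
Variables (K L : fieldType) (iota : {rmorphism K -> L}).
Implicit Types d : cform K.

Lemma res_cmap d : res (cmap iota d) = iota (res d).
Proof.
case: d => *; rewrite /res /inv13 /inv22 /hess0 /hess1 /hess2 /disc /=.
by ring.
Qed.

Lemma cscale_cmap t d : cmap iota (cscale t d) = cscale (iota t) (cmap iota d).
Proof. by rewrite /cmap /cscale /= !rmorphM. Qed.

Lemma act_cmap a b c e d : cmap iota (act a b c e d)
  = act (iota a) (iota b) (iota c) (iota e) (cmap iota d).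
Proof. by case: d => *; rewrite /cmap /=; f_equal; ring. Qed.

Lemma cequiv_cmap d d' : cequiv d d' -> cequiv (cmap iota d) (cmap iota d').
Proof.
case=> [a [b [c [e [t [D0 t0 E]]]]]].
exists (iota a), (iota b), (iota c), (iota e), (iota t).
by rewrite -act_cmap E cscale_cmap -!rmorphM -rmorphB !fmorph_eq0.
Qed.

Hypothesis char3 : (3 : K) != 0.

Lemma ratmap_qmap d : res d != 0 -> ratmap iota (qmap d) = qmap (cmap iota d).
Proof.
move=> d0; rewrite /ratmap.
have [c c0 [-> ->]] := ratnum_ratdenE (qden_neq0 char3 d0) (coprime_qnum_qden char3 d0).
rewrite !map_polyZ -!mul_polyC !tofracM invfM mulrACA divff ?mul1r; last first.
  by rewrite tofrac_eq0 polyC_eq0 fmorph_eq0.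
rewrite /qnum /qden !map_quad /qmap.
by congr (FracField.tofrac _ / FracField.tofrac _); rewrite /qnum /qden /=; congr quad; ring.
Qed.

End CformBaseChange.

(** The two adjacent transpositions generate all permutations of three letters. This carries the
    ordered data [fixdata] to any listing of the multipliers. *)
Lemma perm3_ind (T : eqType) (P : T -> T -> T -> Prop) :
  (forall x y z, P x y z -> P y x z) -> (forall x y z, P x y z -> P x z y) ->
  forall x y z x' y' z', perm_eq [:: x'; y'; z'] [:: x; y; z] ->
  P x y z -> P x' y' z'.
Proof.
move=> sw1 sw2.
have tail x y z y' z' : perm_eq [:: y'; z'] [:: y; z] -> P x y z -> P x y' z'.
  move=> /[dup] /perm_mem /(_ y'); rewrite !inE eqxx /= => /esym/orP[] /eqP->.
    by rewrite perm_cons => /perm_small_eq -/(_ isT) [->].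
  have -> : perm_eq [:: z; z'] [:: y; z] = perm_eq [:: z'] [:: y].
    have /permPr-> : perm_eq [:: y; z] [:: z; y].
      by apply/permP => p /=; case: (p y); case: (p z).
    by rewrite perm_cons.
  by move=> /perm_small_eq -/(_ isT) [->] /sw2.
move=> x y z x' y' z' /[dup] /perm_mem /(_ x').
rewrite !inE eqxx /= => /esym/or3P[] /eqP->.
- by rewrite perm_cons; apply: tail.
- have -> : perm_eq [:: y; y'; z'] [:: x; y; z] = perm_eq [:: y'; z'] [:: x; z].
    have /permPr-> : perm_eq [:: x; y; z] [:: y; x; z].
      by apply/permP => p /=; case: (p x); case: (p y); case: (p z).
    by rewrite perm_cons.
  by move=> /tail h /sw1; apply: h.
have -> : perm_eq [:: z; y'; z'] [:: x; y; z] = perm_eq [:: y'; z'] [:: x; y].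
  have /permPr-> : perm_eq [:: x; y; z] [:: z; x; y].
    by apply/permP => p /=; case: (p x); case: (p y); case: (p z).
  by rewrite perm_cons.
by move=> /tail h /sw2/sw1; apply: h.
Qed.

(** * Fixed points and multipliers *)

Section FixedPointData.
Variable L : fieldType.
Implicit Types (d : cform L) (u v w : L * L).

Definition det2 u v : L := u.1 * v.2 - u.2 * v.1.
Definition ell d u : L := c10 d * u.1 + c01 d * u.2.

Definition has_roots d c u v w := [/\
  c30 d = c * (u.2 * v.2 * w.2),
  c21 d = - c * (u.1 * v.2 * w.2 + u.2 * v.1 * w.2 + u.2 * v.2 * w.1),
  c12 d = c * (u.1 * v.1 * w.2 + u.1 * v.2 * w.1 + u.2 * v.1 * w.1) &
  c03 d = - c * (u.1 * v.1 * w.1)].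

(* [m] is the multiplier at the zero [u] of a cubic form with zeros [u], [v], [w]. *)
Definition mult_at d c u v w (m : L) :=
  (m - 1) * ell d u = (m + 2) * (c * det2 u v * det2 u w).

Definition fixdata d c u v w m1 m2 m3 :=
  [/\ has_roots d c u v w, mult_at d c u v w m1, mult_at d c v u w m2
    & mult_at d c w u v m3].

Lemma fixdata_swap1 d c u v w m1 m2 m3 :
  fixdata d c u v w m1 m2 m3 -> fixdata d c v u w m2 m1 m3.
Proof.
case=> [[E0 E1 E2 E3] M1 M2 M3]; split=> //.
  by rewrite /has_roots E0 E1 E2 E3; split; ring.
by rewrite /mult_at M3; ring.
Qed.

Lemma fixdata_swap2 d c u v w m1 m2 m3 :
  fixdata d c u v w m1 m2 m3 -> fixdata d c u w v m1 m3 m2.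
Proof.
case=> [[E0 E1 E2 E3] M1 M2 M3]; split.
- by rewrite /has_roots E0 E1 E2 E3; split; ring.
- by rewrite /mult_at M1; ring.
- by rewrite /mult_at M3; ring.
- by rewrite /mult_at M2; ring.
Qed.

End FixedPointData.

Definition ptvec (L : fieldType) (x : option L) : L * L :=
  if x is Some a then (a, 1) else (1, 0).

Section SplitCubic.
Variable L : closedFieldType.
Implicit Types (d : cform L).

(** A vanishing leading coefficient counts as a root at infinity, so every binary form splits, the
    zero form included. *)
Lemma split_quadratic (A B C : L) : exists c x y,
  let u := ptvec x in let v := ptvec y in
  [/\ A = c * (u.2 * v.2), B = - c * (u.1 * v.2 + u.2 * v.1) & C = c * (u.1 * v.1)].
Proof.
have [->|A0] := eqVneq A 0.
  have [->|B0] := eqVneq B 0.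
    by exists C, None, None; split=> /=; ring.
  by exists (- B), (Some (- C / B)), None; split=> /=; field.
have [r Er] := @solve_monicpoly L 2 (fun i => if i == 0%N then - C / A else - B / A) isT.
rewrite !big_ord_recl big_ord0 /= expr0 expr1 addr0 mulr1 in Er.
exists A, (Some r), (Some (- B / A - r)); split=> /=; [by ring|by field|].
have -> : A * (r * (- B / A - r)) = - B * r - A * r ^+ 2 by field.
by rewrite Er; field.
Qed.

Lemma split_cubic d : exists c x y z,
  has_roots d c (ptvec x) (ptvec y) (ptvec z).
Proof.
case: d => f0 f1 f2 f3 g0 g1.
have [->|f00] := eqVneq f0 0.
  have [c [x [y [E1 E2 E3]]]] := split_quadratic f1 f2 f3.
  (* The root (1, 0) contributes the factor - y, hence the sign. *)
  by exists (- c), None, x, y; split; rewrite ?E1 ?E2 ?E3 /=; ring.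
have [r Er] := @solve_monicpoly L 3 (fun i =>
  nth 0 [:: - f3 / f0; - f2 / f0; - f1 / f0] i) isT.
rewrite !big_ord_recl big_ord0 /= expr0 expr1 addr0 mulr1 in Er.
(* Synthetic division of the cubic by x - r y. *)
have [c [x [y [E1 E2 E3]]]] := split_quadratic f0 (f1 + f0 * r) (f2 + f1 * r + f0 * r ^+ 2).
exists c, (Some r), x, y; split => /=.
- by rewrite E1; ring.
- transitivity ((f1 + f0 * r) - f0 * r); first by ring.
  by rewrite E2 E1; ring.
- transitivity ((f2 + f1 * r + f0 * r ^+ 2) - r * (f1 + f0 * r)); first by ring.
  by rewrite E3 E2; ring.
transitivity (- r * (f2 + f1 * r + f0 * r ^+ 2)); last by rewrite E3; ring.
have -> : - r * (f2 + f1 * r + f0 * r ^+ 2) = - f2 * r - f1 * r ^+ 2 - f0 * r ^+ 3 by ring.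
by rewrite Er; field.
Qed.

End SplitCubic.

Section FixedPoints.
Variable L : fieldType.
Hypothesis char3 : (3 : L) != 0.
Implicit Types (d : cform L) (u v w : L * L).

Lemma mup_linear (x : L) u : u != (0, 0) ->
  mup x (u.2%:P * 'X - u.1%:P) = (u.2 * x == u.1).
Proof.
case: u => a b /=; rewrite xpair_eqE negb_and => ab0.
have [b0|b0] := eqVneq b 0.
  move: ab0; rewrite b0 eqxx orbF => a0.
  rewrite polyC0 !mul0r sub0r mupNroot; first by rewrite eq_sym (negPf a0).
  by rewrite rootN rootC.
have -> : b%:P * 'X - a%:P = b%:P * ('X - (a / b)%:P) ^+ 1.
  rewrite expr1 mulrBr -polyCM; congr (_ - _%:P).
  by field.
rewrite mupMr ?rootC // mup_XsubCX; have -> : (a / b == x) = (b * x == a).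
  by apply/eqP/eqP => [<-|<-]; field.
by case: eqP.
Qed.

Lemma linear_neq0 u : u != (0, 0) -> u.2%:P * 'X - u.1%:P != 0 :> {poly L}.
Proof.
move=> u0; apply: contra u0 => /eqP h.
have h' i : (u.2%:P * 'X - u.1%:P)`_i = 0 by rewrite h coef0.
have := h' 0%N; have := h' 1%N.
rewrite !coefB !coefCM !coefX !coefC /= mulr1 mulr0 subr0 sub0r => u20 /eqP.
by rewrite oppr_eq0 => /eqP u10; rewrite [u]surjective_pairing u10 u20.
Qed.

Definition cubic d : {poly L} :=
  (c30 d)%:P * 'X^3 + (c21 d)%:P * 'X^2 + (c12 d)%:P * 'X + (c03 d)%:P.

Lemma cubic_factor d c u v w : has_roots d c u v w ->
  cubic d = c%:P * ((u.2%:P * 'X - u.1%:P) *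
    ((v.2%:P * 'X - v.1%:P) * (w.2%:P * 'X - w.1%:P))).
Proof. by case=> E0 E1 E2 E3; rewrite /cubic E0 E1 E2 E3; ring. Qed.

(** Each term of [res] has positive degree in F, so [res d] nonzero forces F to be nonzero. *)
Lemma roots_neq0 d c u v w : res d != 0 -> has_roots d c u v w ->
  [/\ c != 0, u != (0, 0), v != (0, 0) & w != (0, 0)].
Proof.
move=> d0 [E0 E1 E2 E3].
have res0 : c30 d = 0 -> c21 d = 0 -> c12 d = 0 -> c03 d = 0 -> false.
  move=> z0 z1 z2 z3; move: d0.
  rewrite /res /inv13 /inv22 /hess0 /hess1 /hess2 /disc z0 z1 z2 z3.
  by apply: contraNT => _; apply/eqP; ring.
move: E0 E1 E2 E3.
split; apply/negP => /eqP h; suff: false by []; apply: res0;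
  rewrite ?E0 ?E1 ?E2 ?E3 ?h /=; ring.
Qed.

Lemma fin_fixmult_qmap d x : res d != 0 -> fin_fixmult (qmap d) x = mup x (cubic d).
Proof.
move=> d0; rewrite /fin_fixmult.
have [c c0 [-> ->]] := ratnum_ratdenE (qden_neq0 char3 d0) (coprime_qnum_qden char3 d0).
have -> : c *: qnum d - 'X * (c *: qden d) = (c * 3)%:P * cubic d.
  by rewrite -!mul_polyC /qnum /qden /quad /cubic; ring.
by rewrite mupMr // rootC mulf_neq0.
Qed.

Lemma fin_fixmult_roots d c u v w x : res d != 0 -> has_roots d c u v w ->
  fin_fixmult (qmap d) x
  = ((u.2 * x == u.1)%R + ((v.2 * x == v.1)%R + (w.2 * x == w.1)%R))%N.
Proof.
move=> d0 r; rewrite fin_fixmult_qmap // (cubic_factor r).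
have [c0 u0 v0 w0] := roots_neq0 d0 r.
rewrite mupMr ?rootC // mupM ?mulf_neq0 ?linear_neq0 //.
by rewrite mupM ?linear_neq0 // !mup_linear.
Qed.

(** At a fixed point P = x Q, so the derivative is (P' - x Q') / Q. Here Q = l - F_x, and Euler's
    relation for F_x gives P' - x Q' = l + 2 F_x; hence m (l - F_x) = l + 2 F_x. *)
Lemma fin_multiplierE d x : res d != 0 -> root (cubic d) x ->
  let m := fin_multiplier (qmap d) x in
  (m - 1) * (c10 d * x + c01 d)
  = (m + 2) * (3 * c30 d * x ^+ 2 + 2 * c21 d * x + c12 d).
Proof.
move=> d0 rx m; rewrite {}/m /fin_multiplier.
have [c c0 [-> ->]] := ratnum_ratdenE (qden_neq0 char3 d0) (coprime_qnum_qden char3 d0).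
have F0 : (qnum d).[x] = x * (qden d).[x].
  have : (qnum d - 'X * qden d).[x] = 0.
    have -> : qnum d - 'X * qden d = 3%:P * cubic d.
      by rewrite /qnum /qden /quad /cubic; ring.
    by rewrite hornerM (eqP rx) mulr0.
  by rewrite !hornerE => /eqP; rewrite subr_eq0 => /eqP.
have Q0 : (qden d).[x] != 0.
  apply/negP => /eqP Q0; move: F0; rewrite Q0 mulr0 => P0.
  have := coprimep_root (coprime_qnum_qden char3 d0) (introT eqP P0).
  by rewrite Q0 eqxx.
have EP : (qnum d)^`().[x] = 2 * (c21 d + c10 d) * x + (2 * c12 d + c01 d).
  by rewrite /qnum /quad !derivE !(hornerD, hornerM, hornerC, hornerX) /=; ring.
have EQ : (qden d)^`().[x] = 2 * (- 3 * c30 d) * x + (c10 d - 2 * c21 d).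
  by rewrite /qden /quad !derivE !(hornerD, hornerM, hornerC, hornerX) /=; ring.
rewrite !derivZ hornerD hornerN 2!hornerM !hornerZ F0 EP EQ.
move: Q0; rewrite /qden horner_quad => Q0.
by field; rewrite Q0 c0.
Qed.

Definition vswap u : L * L := (u.2, u.1).

(** Each of the three linear factors changes sign under the exchange, hence - c. *)
Lemma has_roots_swap d c u v w : has_roots d c u v w ->
  has_roots (act 0 1 1 0 d) (- c) (vswap u) (vswap v) (vswap w).
Proof.
case: d => f0 f1 f2 f3 g0 g1 [/= -> -> -> ->].
by split=> /=; ring.
Qed.

Lemma ratconj_swap0inf d : res d != 0 ->
  ratconj (swap0inf L) (qmap d) = qmap (act 0 1 1 0 d).
Proof.
move=> d0; rewrite ratconj_qmap // ?unitmx2 !mxE //=.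
by rewrite mul0r sub0r mulr1 oppr_eq0 oner_eq0.
Qed.

Lemma res_swap d : res d != 0 -> res (act 0 1 1 0 d) != 0.
Proof.
move=> d0; rewrite res_act mulf_neq0 // expf_neq0 //.
by rewrite mul0r sub0r mulr1 oppr_eq0 oner_eq0.
Qed.

Lemma fixmult_roots d c (x y z : option L) : res d != 0 ->
  has_roots d c (ptvec x) (ptvec y) (ptvec z) ->
  forall p, count_mem p [:: x; y; z] = fixmult (qmap d) p.
Proof.
move=> d0 r [a|] /=.
  rewrite (fin_fixmult_roots _ d0 r) addn0.
  have E q : (q == Some a) = ((ptvec q).2 * a == (ptvec q).1).
    by case: q => [b|] /=; [rewrite mul1r [RHS]eq_sym|rewrite mul0r [RHS]eq_sym oner_eq0].
  by rewrite !E.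
rewrite ratconj_swap0inf // (fin_fixmult_roots _ (res_swap d0) (has_roots_swap r)) addn0.
have E (q : option L) : (q == None) = ((vswap (ptvec q)).2 * 0 == (vswap (ptvec q)).1).
  by case: q => [b|] /=; rewrite mulr0 ?eqxx // [RHS]eq_sym oner_eq0.
by rewrite !E.
Qed.

Lemma root_cubic d c u v w (a : L) : has_roots d c u v w -> u = (a, 1) ->
  root (cubic d) a.
Proof.
move=> /cubic_factor-> ->; rewrite !rootM /=; apply/or3P/Or32.
by rewrite polyC1 mul1r root_XsubC.
Qed.

Lemma mult_at_multiplier d c (x y z : option L) : res d != 0 ->
  has_roots d c (ptvec x) (ptvec y) (ptvec z) ->
  mult_at d c (ptvec x) (ptvec y) (ptvec z) (multiplier (qmap d) x).
Proof.
move=> d0 r; rewrite /mult_at; case: x r => [a|] r /=.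
  rewrite /ell /= mulr1 fin_multiplierE //; last exact: (root_cubic r).
  by case: r => -> -> -> _ /=; rewrite /det2 /=; ring.
rewrite ratconj_swap0inf //.
have := @fin_multiplierE _ 0 (res_swap d0) (root_cubic (has_roots_swap r) (erefl _)).
case: d {d0} r => f0 f1 f2 f3 g0 g1 [/= -> -> -> ->]; rewrite /ell /det2 /=.
set m := fin_multiplier _ _; move: m => m; set lhs := (X in X = _) => E.
(* The exchange of 0 and infinity has determinant -1, which flips the sign of the linear form. *)
transitivity (- lhs); first by rewrite /lhs; ring.
by rewrite E; ring.
Qed.

Lemma fixdata_multiplier d c (x y z : option L) : res d != 0 ->
  has_roots d c (ptvec x) (ptvec y) (ptvec z) ->
  fixdata d c (ptvec x) (ptvec y) (ptvec z) (multiplier (qmap d) x)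
    (multiplier (qmap d) y) (multiplier (qmap d) z).
Proof.
move=> d0 r.
have r2 : has_roots d c (ptvec y) (ptvec x) (ptvec z).
  by case: r => E0 E1 E2 E3; rewrite /has_roots E0 E1 E2 E3; split; ring.
have r3 : has_roots d c (ptvec z) (ptvec x) (ptvec y).
  by case: r => E0 E1 E2 E3; rewrite /has_roots E0 E1 E2 E3; split; ring.
by split=> //; apply: mult_at_multiplier.
Qed.

Lemma fix_multipliers_uniq (f : {fraction {poly L}}) s s' :
  fix_multipliers f s -> fix_multipliers f s' -> perm_eq s s'.
Proof.
case=> pts cp ps [pts' cp' ps']; apply: perm_trans ps _.
rewrite perm_sym; apply: perm_trans ps' _; apply: perm_map.
by apply/allP => x _ /=; rewrite cp cp'.
Qed.

Lemma fix_multipliers_perm (f : {fraction {poly L}}) s s' :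
  perm_eq s' s -> fix_multipliers f s -> fix_multipliers f s'.
Proof. by move=> pss' [pts cp ps]; exists pts => //; apply: perm_trans ps. Qed.

End FixedPoints.

Section ClosedFixedPoints.
Variable L : closedFieldType.
Hypothesis char3 : (3 : L) != 0.
Implicit Types (d : cform L).

Lemma fix_multipliers_exist d : res d != 0 ->
  exists m1 m2 m3, fix_multipliers (qmap d) [:: m1; m2; m3].
Proof.
move=> d0; have [c [x [y [z r]]]] := split_cubic d.
exists (multiplier (qmap d) x), (multiplier (qmap d) y), (multiplier (qmap d) z).
by exists [:: x; y; z] => //; apply: (fixmult_roots char3 d0 r).
Qed.

Lemma fix_multipliers_fixdata d m1 m2 m3 : res d != 0 ->
  fix_multipliers (qmap d) [:: m1; m2; m3] ->
  exists c u v w, fixdata d c u v w m1 m2 m3.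
Proof.
move=> d0 ms; have [c [x [y [z r]]]] := split_cubic d.
have ms' : fix_multipliers (qmap d)
    [:: multiplier (qmap d) x; multiplier (qmap d) y; multiplier (qmap d) z].
  by exists [:: x; y; z] => //; apply: (fixmult_roots char3 d0 r).
pose P m1 m2 m3 := exists c u v w, fixdata d c u v w m1 m2 m3.
apply: (@perm3_ind _ P _ _ _ _ _ _ _ _ (fix_multipliers_uniq ms ms')).
- by move=> n1 n2 n3 [c' [u [v [w /fixdata_swap1 h]]]]; exists c', v, u, w.
- by move=> n1 n2 n3 [c' [u [v [w /fixdata_swap2 h]]]]; exists c', u, w, v.
by exists c, (ptvec x), (ptvec y), (ptvec z); apply: fixdata_multiplier.
Qed.

End ClosedFixedPoints.

(** * Invariants expressed by roots and multipliers *)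

Section FixedPointAlgebra.
Variable L : fieldType.
Implicit Types (d : cform L) (u v w : L * L).

(* The adjugate of the matrix (a b; c e) applied to [u]. *)
Definition vadj (a b c e : L) u : L * L := (e * u.1 - b * u.2, a * u.2 - c * u.1).

Lemma det2_vadj a b c e u v :
  det2 (vadj a b c e u) (vadj a b c e v) = (a * e - b * c) * det2 u v.
Proof. by rewrite /det2 /vadj /=; ring. Qed.

Lemma ell_vadj a b c e d u :
  ell (act a b c e d) (vadj a b c e u) = (a * e - b * c) ^+ 2 * ell d u.
Proof. by case: d => *; rewrite /ell /vadj /=; ring. Qed.

(** Substituting the matrix in u.2 x - u.1 y gives exactly the factor attached to its adjugate
    applied to u, so the constant k is preserved. An inverse would introduce powers of the
    determinant. *)
Lemma has_roots_act a b c e d k u v w : has_roots d k u v w ->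
  has_roots (act a b c e d) k (vadj a b c e u) (vadj a b c e v) (vadj a b c e w).
Proof. by case: d => f0 f1 f2 f3 g0 g1 [/= -> -> -> ->]; split=> /=; ring. Qed.

Lemma mult_at_act a b c e d k u v w m : mult_at d k u v w m ->
  mult_at (act a b c e d) k (vadj a b c e u) (vadj a b c e v) (vadj a b c e w) m.
Proof.
rewrite /mult_at ell_vadj !det2_vadj => E.
transitivity ((a * e - b * c) ^+ 2 * ((m - 1) * ell d u)); first by ring.
by rewrite E; ring.
Qed.

Lemma fixdata_act a b c e d k u v w m1 m2 m3 : fixdata d k u v w m1 m2 m3 ->
  fixdata (act a b c e d) k (vadj a b c e u) (vadj a b c e v) (vadj a b c e w)
    m1 m2 m3.
Proof.
case=> r M1 M2 M3.
by split; [apply: has_roots_act|apply: mult_at_act..].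
Qed.

Lemma fixdata_cscale t d k u v w m1 m2 m3 : t != 0 ->
  fixdata (cscale t d) (t * k) u v w m1 m2 m3 -> fixdata d k u v w m1 m2 m3.
Proof.
move=> t0 [[E0 E1 E2 E3] M1 M2 M3]; split.
- by split; apply: (mulfI t0);
    [rewrite [LHS]E0|rewrite [LHS]E1|rewrite [LHS]E2|rewrite [LHS]E3]; ring.
- apply: (mulfI t0); transitivity ((m1 - 1) * ell (cscale t d) u).
    by rewrite /ell /=; ring.
  by rewrite M1; ring.
- apply: (mulfI t0); transitivity ((m2 - 1) * ell (cscale t d) v).
    by rewrite /ell /=; ring.
  by rewrite M2; ring.
- apply: (mulfI t0); transitivity ((m3 - 1) * ell (cscale t d) w).
    by rewrite /ell /=; ring.
  by rewrite M3; ring.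
Qed.

Definition has_fixdata d m1 m2 m3 := exists k u v w, fixdata d k u v w m1 m2 m3.

Lemma has_fixdata_cequiv d d' m1 m2 m3 :
  cequiv d d' -> has_fixdata d m1 m2 m3 -> has_fixdata d' m1 m2 m3.
Proof.
case=> [a [b [c [e [t [D0 t0 E]]]]]] [k [u [v [w /(fixdata_act a b c e)]]]].
rewrite E => h; exists (t^-1 * k), (vadj a b c e u), (vadj a b c e v), (vadj a b c e w).
by apply: (fixdata_cscale t0); rewrite mulVKf.
Qed.

Section Invariants.
Variables (d : cform L) (k : L) (u v w : L * L).
Hypothesis r : has_roots d k u v w.
Let l1 := ell d u.
Let l2 := ell d v.
Let l3 := ell d w.
Let e1 := k * det2 u v * det2 u w.
Let e2 := k * det2 v u * det2 v w.
Let e3 := k * det2 w u * det2 w v.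

(** At the zero (c01, - c10) of the linear form, the factor u.2 x - u.1 y takes the value
    [ell d u]. *)
Lemma inv13_roots : inv13 d = k * (l1 * l2 * l3).
Proof.
rewrite /l1 /l2 /l3 /ell /inv13; case: d r => f0 f1 f2 f3 g0 g1 [/= -> -> -> ->]; ring.
Qed.

Lemma inv22_roots : inv22 d = k * (l1 * l2 * e3 + l1 * l3 * e2 + l2 * l3 * e1).
Proof.
rewrite /l1 /l2 /l3 /e1 /e2 /e3 /ell /det2 /inv22 /hess0 /hess1 /hess2.
by case: d r => f0 f1 f2 f3 g0 g1 [/= -> -> -> ->]; ring.
Qed.

Lemma disc_roots : disc d = - k * (e1 * e2 * e3).
Proof.
rewrite /e1 /e2 /e3 /det2 /disc.
by case: d r => f0 f1 f2 f3 g0 g1 [/= -> -> -> ->]; ring.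
Qed.

(* Lagrange interpolation: the linear form [ell d] has degree less than 2. *)
Lemma lagrange_roots : l1 * e2 * e3 + l2 * e1 * e3 + l3 * e1 * e2 = 0.
Proof. by rewrite /l1 /l2 /l3 /e1 /e2 /e3 /ell /det2; ring. Qed.

(** A common zero of P and Q is a fixed point with l_i = e_i. Expanding the product gives inv13 -
    inv22 + disc and the terms linear in the l_i, which cancel by [lagrange_roots]. *)
Lemma res_roots : res d = k * ((l1 - e1) * (l2 - e2) * (l3 - e3)).
Proof.
rewrite /res inv13_roots inv22_roots disc_roots.
transitivity (k * ((l1 - e1) * (l2 - e2) * (l3 - e3))
  - k * (l1 * e2 * e3 + l2 * e1 * e3 + l3 * e1 * e2)); first by ring.
by rewrite lagrange_roots mulr0 subr0.
Qed.

Hypothesis d0 : res d != 0.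

Lemma res_roots_neq0 : [/\ k != 0, l1 - e1 != 0, l2 - e2 != 0 & l3 - e3 != 0].
Proof.
by move: d0; rewrite res_roots !mulf_eq0 !negb_or => /andP[-> /andP[/andP[-> ->] ->]].
Qed.

End Invariants.

Lemma mult_at_eq d k u v w m : mult_at d k u v w m ->
  m * (ell d u - k * det2 u v * det2 u w) = ell d u + 2 * (k * det2 u v * det2 u w).
Proof.
rewrite /mult_at => E.
transitivity ((m - 1) * ell d u + ell d u - m * (k * det2 u v * det2 u w)); first by ring.
by rewrite E; ring.
Qed.

(** Since m_i = (l_i + 2 e_i) / (l_i - e_i), multiplying by R clears all denominators; the terms
    linear in the l_i vanish by the first hypothesis. Treating the l_i and e_i as plain scalars
    keeps the identities small. *)
Lemma sum_quotients (k l1 l2 l3 e1 e2 e3 m1 m2 m3 R I13 I22 Ds : L) :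
  l1 * e2 * e3 + l2 * e1 * e3 + l3 * e1 * e2 = 0 ->
  R = k * ((l1 - e1) * (l2 - e2) * (l3 - e3)) ->
  I13 = k * (l1 * l2 * l3) ->
  I22 = k * (l1 * l2 * e3 + l1 * l3 * e2 + l2 * l3 * e1) ->
  Ds = - k * (e1 * e2 * e3) ->
  m1 * (l1 - e1) = l1 + 2 * e1 -> m2 * (l2 - e2) = l2 + 2 * e2 ->
  m3 * (l3 - e3) = l3 + 2 * e3 ->
  [/\ (m1 + m2 + m3) * R = 3 * I13 - 6 * Ds,
      (m1 * m2 + m1 * m3 + m2 * m3) * R = 3 * I13 + 3 * I22 + 12 * Ds
    & m1 * m2 * m3 * R = I13 + 2 * I22 - 8 * Ds].
Proof.
move=> lag -> -> -> -> M1 M2 M3; split.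
- transitivity (k * (m1 * (l1 - e1) * (l2 - e2) * (l3 - e3)
    + m2 * (l2 - e2) * (l1 - e1) * (l3 - e3)
    + m3 * (l3 - e3) * (l1 - e1) * (l2 - e2))); first by ring.
  rewrite M1 M2 M3.
  transitivity (3 * (k * (l1 * l2 * l3)) - 6 * (- k * (e1 * e2 * e3))
     - 3 * k * (l1 * e2 * e3 + l2 * e1 * e3 + l3 * e1 * e2)); first by ring.
  by rewrite lag; ring.
- transitivity (k * ((m1 * (l1 - e1)) * (m2 * (l2 - e2)) * (l3 - e3)
    + (m1 * (l1 - e1)) * (m3 * (l3 - e3)) * (l2 - e2)
    + (m2 * (l2 - e2)) * (m3 * (l3 - e3)) * (l1 - e1))); first by ring.
  by rewrite M1 M2 M3; ring.
transitivity (k * ((m1 * (l1 - e1)) * (m2 * (l2 - e2)) * (m3 * (l3 - e3)))); first by ring.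
rewrite M1 M2 M3.
transitivity (k * (l1 * l2 * l3)
     + 2 * (k * (l1 * l2 * e3 + l1 * l3 * e2 + l2 * l3 * e1)) - 8 * (- k * (e1 * e2 * e3))
     + 4 * k * (l1 * e2 * e3 + l2 * e1 * e3 + l3 * e1 * e2)); first by ring.
by rewrite lag; ring.
Qed.

Lemma has_fixdata_sym d m1 m2 m3 : has_fixdata d m1 m2 m3 ->
  [/\ (m1 + m2 + m3) * res d = 3 * inv13 d - 6 * disc d,
      (m1 * m2 + m1 * m3 + m2 * m3) * res d = 3 * inv13 d + 3 * inv22 d + 12 * disc d
    & m1 * m2 * m3 * res d = inv13 d + 2 * inv22 d - 8 * disc d].
Proof.
case=> [k [u [v [w [r /mult_at_eq M1 /mult_at_eq M2 /mult_at_eq M3]]]]].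
exact: sum_quotients (lagrange_roots d k u v w) (res_roots r) (inv13_roots r)
  (inv22_roots r) (disc_roots r) M1 M2 M3.
Qed.

(** When no multiplier is 1, this is the fixed point formula that the 1 / (1 - m_i) add up to 1,
    cleared of denominators; this form also covers multiple fixed points. *)
Lemma has_fixdata_prod d m1 m2 m3 : res d != 0 -> has_fixdata d m1 m2 m3 ->
  m1 * m2 * m3 = m1 + m2 + m3 - 2.
Proof.
move=> d0 /has_fixdata_sym [E1 _ E3]; apply: (mulIf d0).
rewrite E3; transitivity ((m1 + m2 + m3) * res d - 2 * res d); last by ring.
by rewrite E1 /res; ring.
Qed.

End FixedPointAlgebra.

(** * The three cases *)

Section MultiplierCases.
Variable L : fieldType.
Hypothesis char3 : (3 : L) != 0.
Implicit Types (d : cform L) (m : L).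

Lemma opp2_neq1 : (- 2 : L) != 1.
Proof.
apply: contra char3 => /eqP h; apply/eqP.
by transitivity (1 - (- 2) : L); [ring|rewrite h; ring].
Qed.

(** For a repeated multiplier m and third one n the relation factors as (m - 1) ((m + 1) n - 2) = 0.
    If m = 1, then n decides between (a) and (b); if m differs from 1, then n = m forces m = -2. *)
Lemma multiplier_trichotomy m1 m2 m3 : m1 * m2 * m3 = m1 + m2 + m3 - 2 ->
  exists l1 l2 l3, perm_eq [:: l1; l2; l3] [:: m1; m2; m3] /\
    [\/ caseA l1 l2 l3, caseB l1 l2 l3 | caseC l1 l2 l3].
Proof.
have main m n : m * m * n = m + m + n - 2 ->
    [\/ caseA m m n, caseB m m n | caseC m m n].
  move=> E; have : (m - 1) * ((m + 1) * n - 2) = 0.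
    transitivity (m * m * n - (m + m + n - 2)); first by ring.
    by rewrite E subrr.
  have [->|m_1] := eqVneq m 1 => [_|/eqP].
    have [->|n1] := eqVneq n 1; first by constructor 2; right.
    by constructor 1; right; rewrite /= eqxx (negPf n1).
  rewrite mulf_eq0 subr_eq0 (negPf m_1) /= => /eqP E'.
  have [nm|nm] := eqVneq n m; last by constructor 2; left; split=> //; apply/eqP.
  constructor 3; have /eqP : (m - 1) * (m + 2) = 0.
    by rewrite -[RHS]E' nm; ring.
  by rewrite mulf_eq0 subr_eq0 (negPf m_1) addr_eq0 nm => /eqP->.
move=> E.
have [u|] := boolP (uniq [:: m1; m2; m3]).
  by exists m1, m2, m3; split=> //; constructor 1; left.
rewrite /= !inE andbT !negb_and !negbK => /orP[/orP[]|] /eqP e.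
- by exists m1, m2, m3; split=> //; rewrite -e in E *; apply: main.
- exists m1, m3, m2; split.
    by apply/permP => p /=; case: (p m1); case: (p m2); case: (p m3).
  by rewrite -e in E *; apply: main; transitivity (m1 * m2 * m1); [ring|rewrite E; ring].
exists m2, m3, m1; split.
  by apply/permP => p /=; case: (p m1); case: (p m2); case: (p m3).
by rewrite -e in E *; apply: main; transitivity (m1 * m2 * m2); [ring|rewrite E; ring].
Qed.

Lemma caseA_perm m1 m2 m3 n1 n2 n3 :
  perm_eq [:: m1; m2; m3] [:: n1; n2; n3] -> caseA n1 n2 n3 -> caseA m1 m2 m3.
Proof. by move=> p [u|c]; [left|right]; [rewrite (perm_uniq p)|rewrite (permP p)]. Qed.

Lemma caseC_perm m1 m2 m3 n1 n2 n3 :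
  perm_eq [:: m1; m2; m3] [:: n1; n2; n3] -> caseC n1 n2 n3 -> caseC m1 m2 m3.
Proof.
move=> p [e1 e2 e3]; move/perm_mem: p => p.
by split; apply/eqP; [have := p m1|have := p m2|have := p m3];
  rewrite e1 e2 e3 !inE eqxx ?orbT !orbb => /esym.
Qed.

Lemma caseA_notB m1 m2 m3 : caseA m1 m2 m3 -> ~ caseB m1 m2 m3.
Proof.
move=> A [[e1 e2 e3]|[e1 e2 e3]]; case: A.
- by rewrite /= e1 !inE eqxx.
- move/eqP: e2; rewrite e1 /= => /negPf->.
  by case: (m3 == 1).
- by rewrite /= e1 e2 !inE eqxx.
by rewrite /= e1 e2 e3 eqxx.
Qed.

Lemma caseA_notC m1 m2 m3 : caseA m1 m2 m3 -> ~ caseC m1 m2 m3.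
Proof.
move=> A [e1 e2 e3]; case: A; rewrite /= e1 e2 e3 ?inE ?eqxx //.
by rewrite (negPf opp2_neq1).
Qed.

Lemma caseB_notC m1 m2 m3 : caseB m1 m2 m3 -> ~ caseC m1 m2 m3.
Proof.
move=> [[e1 e2 e3]|[e1 e2 e3]] [e1' e2' e3']; first by apply: e3; rewrite e3' e1'.
by move/eqP: opp2_neq1; apply; rewrite -e1' e1.
Qed.

Lemma ell0_caseC d m1 m2 m3 : res d != 0 -> has_fixdata d m1 m2 m3 ->
  c10 d = 0 -> c01 d = 0 -> caseC m1 m2 m3.
Proof.
move=> d0 [k [u [v [w [r M1 M2 M3]]]]] z0 z1.
have [k0 n1 n2 n3] := res_roots_neq0 r d0.
have l0 x : ell d x = 0 by rewrite /ell z0 z1 !mul0r addr0.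
have aux m e : (m - 1) * 0 = (m + 2) * e -> 0 - e != 0 -> m = - 2.
  move=> /esym/eqP; rewrite mulr0 mulf_eq0 sub0r oppr_eq0 => /orP[|->//].
  by rewrite addr_eq0 => /eqP.
move: M1 M2 M3; rewrite /mult_at !l0 in n1 n2 n3 *.
by move=> /aux/(_ n1) -> /aux/(_ n2) -> /aux/(_ n3) ->.
Qed.

(** A multiplier -2 makes l vanish at its fixed point. The points u and v are independent, because
    otherwise l and e1 would both vanish at u, against [res d] nonzero; a linear form with two
    independent zeros is 0. *)
Lemma caseC_ell0 d : res d != 0 -> has_fixdata d (- 2) (- 2) (- 2) ->
  c10 d = 0 /\ c01 d = 0.
Proof.
move=> d0 [k [u [v [w [r M1 M2 M3]]]]].
have [k0 n1 n2 n3] := res_roots_neq0 r d0.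
have aux x e : ((- 2 : L) - 1) * x = (- 2 + 2) * e -> x = 0.
  by rewrite addNr mul0r => /eqP; rewrite mulf_eq0 subr_eq0 (negPf opp2_neq1) => /eqP.
move: M1 M2; rewrite /mult_at => /aux lu /aux lv.
have uv0 : det2 u v != 0.
  by apply: contra n1 => /eqP->; rewrite lu !(mulr0, mul0r) subr0.
split; apply: (mulIf uv0); rewrite mul0r.
  transitivity (ell d u * v.2 - ell d v * u.2); first by rewrite /ell /det2; ring.
  by rewrite lu lv !mul0r subr0.
transitivity (ell d v * u.1 - ell d u * v.1); first by rewrite /ell /det2; ring.
by rewrite lu lv !mul0r subr0.
Qed.

(* The cubic covariant at the zero (1, 0) of the linear form y: it vanishes when
   one fixed point is the harmonic conjugate of (1, 0) with respect to the other
   two. *)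
Definition harm (f0 f1 f2 f3 : L) := 2 * f1 ^+ 3 - 9 * f0 * f1 * f2 + 27 * f0 ^+ 2 * f3.

(** In affine coordinates this is u + v - 2 w: it vanishes when w is the midpoint of u and v. *)
Definition harm_factor (u v w : L * L) : L := u.2 * det2 v w + v.2 * det2 u w.

Lemma harm_roots f0 f1 f2 f3 g0 g1 k u v w :
  has_roots (CForm f0 f1 f2 f3 g0 g1) k u v w ->
  harm f0 f1 f2 f3
  = k ^+ 3 * (harm_factor u v w * harm_factor u w v * harm_factor v w u).
Proof. by case=> /= -> -> -> ->; rewrite /harm /harm_factor /det2; ring. Qed.

Section NormalForm.
Hypothesis char2 : (2 : L) != 0.
Variables f0 f1 f2 f3 : L.
Let d := CForm f0 f1 f2 f3 0 1.
Hypothesis d0 : res d != 0.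

Lemma ell_normal u : ell d u = u.2.
Proof. by rewrite /ell /= mul0r add0r mul1r. Qed.

(** The multiplier depends only on the ratio of e to l, and u.2 e2 - v.2 e1 is a multiple of
    [harm_factor u v w], so m1 = m2. If both are 1, then e1 = e2 = 0 and the roots coincide enough
    to give e3 = 0. The conclusion is shaped to contradict [caseA]. *)
Lemma harm_factor_eq0 k u v w m1 m2 m3 : fixdata d k u v w m1 m2 m3 ->
  harm_factor u v w = 0 -> m1 = m2 /\ (m1 = 1 -> m3 = 1).
Proof.
move=> [r /mult_at_eq M1 /mult_at_eq M2 /mult_at_eq M3] h0.
have := res_roots_neq0 r d0; rewrite !ell_normal in M1 M2 M3 * => -[k0 n1 n2 n3].
set e1 := k * _ * _ in M1 n1; set e2 := k * _ * _ in M2 n2; set e3 := k * _ * _ in M3 n3.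
have E12 : u.2 * e2 = v.2 * e1.
  apply/eqP; rewrite -subr_eq0; apply/eqP.
  transitivity (- k * det2 u v * harm_factor u v w).
    by rewrite /e1 /e2 /harm_factor /det2; ring.
  by rewrite h0 mulr0.
have m12 : m1 = m2.
  apply: (mulIf n1); apply: (mulIf n2); rewrite M1.
  transitivity ((u.2 - e1) * (v.2 + 2 * e2)); last by rewrite -M2; ring.
  transitivity (u.2 * v.2 - 2 * e1 * e2 + 2 * (v.2 * e1) - u.2 * e2); first by ring.
  by rewrite -E12; transitivity (u.2 * v.2 - 2 * e1 * e2 + 2 * (u.2 * e2) - v.2 * e1);
    [rewrite -E12|]; ring.
split=> // m1_1; move: M1 M2; rewrite -m12 m1_1 !mul1r => M1 M2.
have e_0 (x e : L) : x - e = x + 2 * e -> e = 0.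
  move=> h; apply: (mulfI char3); rewrite mulr0.
  by transitivity ((x + 2 * e) - (x - e)); [ring|rewrite h subrr].
have {M1} e10 := e_0 _ _ M1; have {M2} e20 := e_0 _ _ M2.
rewrite e10 subr0 in n1; rewrite e20 subr0 in n2.
suff e30 : e3 = 0.
  by rewrite e30 subr0 in n3 M3; apply: (mulIf n3); rewrite M3; ring.
have [uw|uw] := eqVneq (det2 u w) 0.
  rewrite /e3 /det2 in uw *.
  transitivity (- k * (u.1 * w.2 - u.2 * w.1) * (w.1 * v.2 - w.2 * v.1)); first by ring.
  by rewrite uw; ring.
have uv : det2 u v = 0.
  by move/eqP: e10; rewrite !mulf_eq0 (negPf k0) (negPf uw) orbF => /eqP.
(* For parallel u and v the two terms of [harm_factor] agree, so their sum is a double. *)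
have /eqP : 2 * u.2 * det2 v w = 0.
  transitivity (harm_factor u v w - w.2 * det2 u v).
    by rewrite /harm_factor /det2; ring.
  by rewrite h0 uv mulr0 subr0.
rewrite !mulf_eq0 (negPf char2) (negPf n1) /= => /eqP vw.
transitivity (- k * det2 w u * det2 v w); first by rewrite /e3 /det2; ring.
by rewrite vw mulr0.
Qed.

Lemma caseA_harm m1 m2 m3 :
  has_fixdata d m1 m2 m3 -> caseA m1 m2 m3 -> harm f0 f1 f2 f3 != 0.
Proof.
move=> [k [u [v [w h]]]] A; have r : has_roots d k u v w by case: h.
have [k0 _ _ _] := res_roots_neq0 r d0.
have aux m n l : m = n /\ (m = 1 -> l = 1) -> ~ caseA m n l.
  move=> [-> nl] [|] /=; first by rewrite !inE eqxx.
  have [/nl->|_] := eqVneq n 1; first by rewrite eqxx.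
  by case: (l == 1).
have h23 := fixdata_swap2 h; have h231 := fixdata_swap2 (fixdata_swap1 h).
apply/negP => /eqP; rewrite (harm_roots r) => /eqP.
rewrite !mulf_eq0 (negPf k0) /= => /orP[/orP[]|] /eqP z.
- exact: aux (harm_factor_eq0 h z) A.
- apply: aux (harm_factor_eq0 h23 z) _; apply: caseA_perm A.
  by apply/permP => p /=; case: (p m1); case: (p m2); case: (p m3).
apply: aux (harm_factor_eq0 h231 z) _; apply: caseA_perm A.
by apply/permP => p /=; case: (p m1); case: (p m2); case: (p m3).
Qed.

Lemma mult1_parallel k u v w : fixdata d k u v w 1 1 1 ->
  [\/ det2 u v = 0 /\ det2 u w = 0, det2 u v = 0 /\ det2 v w = 0
    | det2 u w = 0 /\ det2 v w = 0].
Proof.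
move=> [r M1 M2 M3]; have [k0 _ _ _] := res_roots_neq0 r d0.
have det2C (x y : L * L) : det2 x y = - det2 y x by rewrite /det2; ring.
move: M1 M2 M3; rewrite /mult_at subrr !mul0r => /esym/eqP + /esym/eqP + /esym/eqP.
have -> : (1 + 2 : L) = 3 by ring.
rewrite (det2C v u) (det2C w u) (det2C w v).
rewrite !mulf_eq0 !oppr_eq0 (negPf char3) (negPf k0) /=.
by move=> /orP[]/eqP uv /orP[]/eqP vw /orP[]/eqP uw;
  first [by constructor 1|by constructor 2|by constructor 3].
Qed.

(** Cross-multiplying the relations at u and v by v.2 and u.2 eliminates the linear form and leaves
    (m + 2) k det(u, v) times the factor. Parallel u and v would give m = 1, and m = -2 would send
    both u and v to infinity. *)
Lemma double_multiplier_harm_factor k u v w m m' :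
  m <> 1 -> fixdata d k u v w m m m' -> harm_factor u v w = 0.
Proof.
move=> m_1 [r]; have [k0 n1 n2 n3] := res_roots_neq0 r d0.
have {m_1} m_1 : m - 1 != 0 by rewrite subr_eq0; apply/eqP.
move=> + + _; rewrite /mult_at !ell_normal => M1 M2.
have uv0 : det2 u v != 0.
  apply/negP => /eqP uv; move: n1 M1 => /=.
  rewrite uv !(mulr0, mul0r) subr0 ell_normal => n1 /eqP.
  by rewrite mulf_eq0 (negPf m_1) (negPf n1).
have m2_0 : m + 2 != 0.
  apply/negP => /eqP m2_0.
  have {}M1 : u.2 = 0 by apply: (mulfI m_1); rewrite M1 m2_0; ring.
  have {}M2 : v.2 = 0 by apply: (mulfI m_1); rewrite M2 m2_0; ring.
  by move: uv0; rewrite /det2 M1 M2 mulr0 mul0r subr0 eqxx.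
have /eqP : (m + 2) * (k * det2 u v * harm_factor u v w) = 0.
  transitivity ((m - 1) * u.2 * v.2 - (m - 1) * v.2 * u.2); last by ring.
  by rewrite M1 M2 /harm_factor /det2; ring.
by rewrite !mulf_eq0 (negPf m2_0) (negPf k0) (negPf uv0) => /eqP.
Qed.

Lemma caseB_harm m1 m2 m3 :
  has_fixdata d m1 m2 m3 -> caseB m1 m2 m3 -> harm f0 f1 f2 f3 = 0.
Proof.
move=> [k [u [v [w h]]]] B; have r : has_roots d k u v w by case: h.
have [k0 n1 n2 n3] := res_roots_neq0 r d0.
rewrite (harm_roots r).
have det2C (x y : L * L) : det2 x y = - det2 y x by rewrite /det2; ring.
case: B h => [[<- m1_1 _]|[-> -> ->]] h; last first.
  rewrite /harm_factor.
  by case: (mult1_parallel h) => -[e e'];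
    rewrite ?(det2C w v) ?(det2C w u) ?(det2C v u) ?e ?e' ?oppr0; ring.
by rewrite (double_multiplier_harm_factor m1_1 h) !(mul0r, mulr0).
Qed.

End NormalForm.

(** With a double multiplier other than 1, w = 0 and u = - v in affine coordinates, and the
    x-derivative of f0 x^3 + f2 x at u is -2 f2. If all multipliers are 1, the discriminant -4 f0
    f2^3 vanishes and f2 = 0. *)
Lemma caseB_multiplier (f0 f2 m1 m2 m3 : L) :
  let d := CForm f0 0 f2 0 0 1 in
  (2 : L) != 0 -> res d != 0 -> f0 != 0 ->
  has_fixdata d m1 m2 m3 -> caseB m1 m2 m3 -> m1 * (1 + 2 * f2) = 1 - 4 * f2.
Proof.
move=> d char2 d0 f00 [k [u [v [w h]]]] B; have r : has_roots d k u v w by case: h.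
have [k0 _ _ _] := res_roots_neq0 r d0.
case: B h => [[<- m1_1 _]|[-> -> ->]] h; last first.
  have e0 : det2 u v * det2 u w * det2 v w = 0.
    by case: (mult1_parallel d0 h) => -[-> ->]; ring.
  have : disc d = 0.
    rewrite (disc_roots r); transitivity (k ^+ 4 * (det2 u v * det2 u w * det2 v w) ^+ 2).
      by rewrite /det2; ring.
    by rewrite e0; ring.
  rewrite /disc /= => /eqP e; suff -> : f2 = 0 by ring.
  have : 2 * 2 * f0 * f2 ^+ 3 == 0.
    rewrite -oppr_eq0; apply: etrans e; congr (_ == _); ring.
  by rewrite !mulf_eq0 (negPf char2) (negPf f00) /= !orbb => /eqP.
have hz := double_multiplier_harm_factor d0 m1_1 h.
case: h => -[/= E0 E1 E2 E3] /mult_at_eq + _ _; rewrite ell_normal => M1.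
have S : u.1 * v.2 * w.2 + u.2 * v.1 * w.2 + u.2 * v.2 * w.1 = 0.
  by apply: (mulfI k0); apply: oppr_inj; rewrite -mulNr -E1 mulr0 oppr0.
move: f00; rewrite E0 !mulf_eq0 !negb_or => /andP[_ /andP[/andP[u2 v2] w2]].
have w1 : w.1 = 0.
  have /eqP : 3 * (u.2 * v.2 * w.1) = 0.
    transitivity (u.1 * v.2 * w.2 + u.2 * v.1 * w.2 + u.2 * v.2 * w.1 - harm_factor u v w).
      by rewrite /harm_factor /det2; ring.
    by rewrite S hz subrr.
  by rewrite !mulf_eq0 (negPf char3) (negPf u2) (negPf v2) => /eqP.
have uv : u.1 * v.2 = - (u.2 * v.1).
  apply: (mulIf w2); apply/eqP; rewrite -subr_eq0; apply/eqP.
  by rewrite -[RHS]S w1; ring.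
have e1 : k * det2 u v * det2 u w = - 2 * u.2 * f2.
  rewrite E2 w1 /det2 w1.
  transitivity (k * (u.1 * v.2) * u.1 * w.2 - k * u.2 * v.1 * u.1 * w.2); first by ring.
  by rewrite uv; ring.
apply: (mulfI u2); rewrite e1 in M1.
transitivity (m1 * (u.2 - - 2 * u.2 * f2)); first by ring.
by rewrite M1; ring.
Qed.

End MultiplierCases.

Lemma divD_mul (L : fieldType) (k b x : L) : x != 0 ->
  k * x + b / x = (k * x ^+ 2 + b) / x.
Proof. by move=> x0; field. Qed.

(** * Normal forms *)

Section NormalForms.
Variable K : fieldType.
Hypothesis char2 : (2 : K) != 0.
Hypothesis char3 : (3 : K) != 0.
Implicit Types (d : cform K).

Local Notation "p %:F" := (FracField.tofrac p).

(** The three forms encode 3 times the displayed numerators and denominators, which avoids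
    fractions. The cubic here is the product of the x - m_i y, since m1 m2 m3 = s1 - 2: the fixed
    points of the normal form are its multipliers. *)
Definition cformA (s1 s2 : K) : cform K :=
  CForm 1 (- s1) s2 (2 - s1) (6 + s1) (6 - 3 * s1 - 2 * s2).

Definition cformB (k b : K) : cform K := CForm 0 (k - 1) 0 b (2 * k + 1) 0.

Definition cformC (d k : K) : cform K := CForm (- 1) (3 * k) (- 3 * d) (d * k) 0 0.

Lemma qmap_quad d (a b c a' b' c' : K) :
  qnum d = quad (3 * a) (3 * b) (3 * c) -> qden d = quad (3 * a') (3 * b') (3 * c') ->
  qmap d = (quad a b c)%:F / (quad a' b' c')%:F.
Proof.
rewrite /qmap => -> ->.
have E x y z : quad (3 * x) (3 * y) (3 * z) = 3%:P * quad x y z :> {poly K}.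
  by rewrite /quad; ring.
by rewrite !E !tofracM invfM mulrACA divff ?mul1r // tofrac_eq0 polyC_eq0.
Qed.

Lemma phiA_qmap s1 s2 : phiA s1 s2 = qmap (cformA s1 s2).
Proof.
rewrite (@qmap_quad _ 2 (2 - s1) (2 - s1) (- 1) (2 + s1) (2 - s1 - s2)).
- by rewrite !tofrac_quad rmorphN1 mulN1r rmorph_nat.
- by rewrite /qnum /=; congr quad; ring.
by rewrite /qden /=; congr quad; ring.
Qed.

Lemma phiB_qmap k b : phiB k b = qmap (cformB k b).
Proof.
rewrite (@qmap_quad _ k 0 b 0 1 0).
- have X0 : ratX K != 0 by rewrite tofrac_eq0 polyX_eq0.
  by rewrite !tofrac_quad !rmorph0 rmorph1 !mul0r mul1r !addr0 add0r /phiB divD_mul.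
- by rewrite /qnum /=; congr quad; ring.
by rewrite /qden /=; congr quad; ring.
Qed.

Lemma thetaC_qmap (d k : K) : thetaC d k = qmap (cformC d k).
Proof.
rewrite (@qmap_quad _ k (- (2 * d)) (d * k) 1 (- (2 * k)) d).
- by rewrite !tofrac_quad !rmorphN rmorph1 !mulNr mul1r.
- by rewrite /qnum /=; congr quad; ring.
by rewrite /qden /=; congr quad; ring.
Qed.

(** The first column of the matrix is the zero (c01, - c10) of the linear form, which kills the
    coefficient of x; the second is a basis vector that makes it invertible. *)
Lemma cequiv_ell d : (c10 d != 0) || (c01 d != 0) ->
  exists f0 f1 f2 f3, cequiv d (CForm f0 f1 f2 f3 0 1).
Proof.
have aux d1 a b c e (t := c01 (act a b c e d1)) : a * e - b * c != 0 -> t != 0 ->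
    c10 (act a b c e d1) = 0 -> exists f0 f1 f2 f3, cequiv d1 (CForm f0 f1 f2 f3 0 1).
  move=> D0 t0 z; set d' := act a b c e d1 in t t0 z.
  exists (c30 d' / t), (c21 d' / t), (c12 d' / t), (c03 d' / t).
  exists a, b, c, e, t; split=> //; rewrite -/d' /cscale /= mulr0 mulr1.
  by rewrite ![t * _]mulrC !divfK //; case: d' @t z t0 => /= *; congr CForm.
have [g10|g10 /=] := eqVneq (c01 d) 0.
  rewrite orbF => g00; apply: (aux d 0 1 (- c10 d) 0);
    case: d g00 g10 => /= f0 f1 f2 f3 g0 g1 g00 g10.
  - by rewrite mul0r mul1r sub0r opprK.
  - have -> : (0 * 0 - 1 * - g0) * (g0 * 1 + g1 * 0) = g0 ^+ 2 by ring.
    by rewrite expf_neq0.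
  by rewrite g10; ring.
move=> _; apply: (aux d (c01 d) 0 (- c10 d) 1); case: d g10 => /= f0 f1 f2 f3 g0 g1 g10.
- by rewrite mulr1 mul0r subr0.
- have -> : (g1 * 1 - 0 * - g0) * (g0 * 0 + g1 * 1) = g1 ^+ 2 by ring.
  by rewrite expf_neq0.
by ring.
Qed.

(** At a root z of F(z, 1) the multiplier is (1 + 2 F') / (1 - F'), with F' = 3 f0 z^2 + 2 f1 z +
    f2. Subtracting 9 f0 F from (3 f0 z + f1) F' leaves n0 z + n1, so F' may be replaced by (n0 z +
    n1) / (3 f0 z + f1). The resulting Moebius map has determinant 3 [harm]. *)
Lemma cequiv_cformA (f0 f1 f2 f3 : K) (d := CForm f0 f1 f2 f3 0 1) :
  res d != 0 -> harm f0 f1 f2 f3 != 0 ->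
  cequiv d (cformA ((3 * inv13 d - 6 * disc d) / res d)
                  ((3 * inv13 d + 3 * inv22 d + 12 * disc d) / res d)).
Proof.
move=> d0 h0; apply: cequiv_sym.
(* For the matrix below, z |-> (a z + b) / (c z + e) sends each fixed point to its
   multiplier. *)
pose n0 := 2 * f1 ^+ 2 - 6 * f0 * f2; pose n1 := f1 * f2 - 9 * f0 * f3.
exists (3 * f0 + 2 * n0), (f1 + 2 * n1), (3 * f0 - n0), (f1 - n1),
  (- 27 * harm f0 f1 f2 f3 ^+ 2 / res d); split.
- have -> : (3 * f0 + 2 * n0) * (f1 - n1) - (f1 + 2 * n1) * (3 * f0 - n0)
      = 3 * harm f0 f1 f2 f3 by rewrite /n0 /n1 /harm; ring.
  by rewrite mulf_neq0.
- have n27 : (- 27 : K) != 0.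
    have -> : (- 27 : K) = - 3 ^+ 3 by ring.
    by rewrite oppr_eq0 expf_neq0.
  by rewrite !mulf_neq0 ?invr_eq0.
have E3 : res d = inv13 d - inv22 d + disc d by [].
move: d0; rewrite /cformA /cscale /=; set R := res d in E3 *.
have ER : R = inv13 d - inv22 d + disc d by [].
move: R ER {E3} => R ER R0.
have I13 : inv13 d = f0 by rewrite /inv13 /=; ring.
have I22 : inv22 d = f1 ^+ 2 - 3 * f0 * f2 by rewrite /inv22 /hess0 /hess1 /hess2 /=; ring.
rewrite I13 I22 in ER *; rewrite /disc /= in ER *.
rewrite /n0 /n1 /harm {R}ER in R0 *; congr CForm.
all: by field; rewrite ?exprMn.
Qed.

(** The translation that removes the x^2 y term turns the last coefficient into harm / (27 f0^2),
    which is 0. If f0 were 0, [harm] would be 2 f1^3, so f1 = 0 and [res d] would vanish. *)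
Lemma harm0_depressed (f0 f1 f2 f3 : K) (d := CForm f0 f1 f2 f3 0 1) :
  res d != 0 -> harm f0 f1 f2 f3 = 0 ->
  exists f2', cequiv d (CForm f0 0 f2' 0 0 1).
Proof.
move=> d0 h0.
have f00 : f0 != 0.
  apply/negP => /eqP z; move: h0 d0; rewrite /d z /harm => h0.
  have f10 : f1 = 0.
    have : 2 * f1 ^+ 3 == 0 by rewrite -h0; apply/eqP; ring.
    by rewrite !mulf_eq0 (negPf char2) /= !orbb => /eqP.
  rewrite f10; apply/negP/negPn/eqP.
  by rewrite /res /inv13 /inv22 /hess0 /hess1 /hess2 /disc /=; ring.
pose b := - f1 / (3 * f0).
exists (f2 + 2 * f1 * b + 3 * f0 * b ^+ 2), 1, b, 0, 1, 1.
split; rewrite ?oner_neq0 //; first by rewrite mulr1 mulr0 subr0 oner_neq0.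
rewrite /cscale /=; congr CForm; rewrite ?/b; try by field; rewrite ?f00 ?char3.
transitivity (harm f0 f1 f2 f3 / (27 * f0 ^+ 2)); last by rewrite h0 mul0r mulr0.
rewrite /harm; field; rewrite ?f00 ?char3 //.
have -> : (27 : K) = 3 ^+ 3 by ring.
by rewrite expf_neq0.
Qed.

(** After exchanging the coordinates it remains to solve t (k - 1) = f2, t b = f0 and t (2 k + 1) =
    -1. The factorization of [res d] supplies the nonvanishing of f0, 1 - f2 and 1 + 2 f2. *)
Lemma cequiv_cformB (f0 f2 : K) (d := CForm f0 0 f2 0 0 1) : res d != 0 ->
  let k := (1 - f2) / (1 + 2 * f2) in let b := - 3 * f0 / (1 + 2 * f2) in
  [/\ 1 + 2 * f2 != 0, paramB k b & cequiv d (cformB k b)].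
Proof.
have -> : res d = f0 * (1 - f2) * (1 + 2 * f2) ^+ 2.
  by rewrite /res /inv13 /inv22 /hess0 /hess1 /hess2 /disc /=; ring.
rewrite !mulf_eq0 orbb !negb_or => /andP[/andP[f00 f21] f22] k b; split=> //.
  split.
  - by apply/eqP; rewrite mulf_neq0 ?invr_eq0.
  - move=> h; move/eqP: char3; apply.
    transitivity (2 * (1 + 2 * f2) * (k + 1 / 2)).
      by rewrite /k; field; rewrite f22 char2.
    by rewrite h addNr mulr0.
  - by apply/eqP; rewrite !mulf_neq0 ?invr_eq0 ?oppr_eq0.
exists 0, 1, 1, 0, (- (1 + 2 * f2) / 3); split.
- by rewrite mulr0 mulr1 sub0r oppr_eq0 oner_eq0.
- by rewrite mulf_neq0 ?invr_eq0 ?oppr_eq0.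
by rewrite /cscale /= /k /b; congr CForm; field; rewrite ?f22 ?char3.
Qed.

Lemma cequiv_act a b c e d : a * e - b * c != 0 -> cequiv d (act a b c e d).
Proof.
by move=> D0; exists a, b, c, e, 1; rewrite cscale1; split; rewrite ?oner_neq0.
Qed.

Lemma cequiv_ell0 d d' : cequiv d d' ->
  c10 d = 0 -> c01 d = 0 -> c10 d' = 0 /\ c01 d' = 0.
Proof.
case=> [a [b [c [e [t [_ t0]]]]]].
case: d d' => f0 f1 f2 f3 g0 g1 [? ? ? ? h0 h1] /= [_ _ _ _ E0 E1] z0 z1.
by split; apply: (mulfI t0); [rewrite -E0|rewrite -E1]; rewrite z0 z1; ring.
Qed.

Lemma disc_res d : c10 d = 0 -> c01 d = 0 -> res d = disc d.
Proof. by move=> z0 z1; rewrite /res /inv13 /inv22 z0 z1; ring. Qed.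

(** The Hessian is a nondegenerate quadratic form by [disc_hess], so completing the square
    diagonalises it over K. *)
Lemma hess_diagonal d : disc d != 0 ->
  exists d', [/\ cequiv d d', hess0 d' != 0, hess1 d' = 0 & c30 d' != 0].
Proof.
move=> d0.
have swap0 : (0 : K) * 0 - 1 * 1 != 0 by rewrite mulr0 mulr1 sub0r oppr_eq0 oner_eq0.
have disc_neq0 d1 : cequiv d d1 -> disc d1 != 0.
  case=> [a [b [c [e [t [D0 t0 E]]]]]].
  have : disc (act a b c e d) != 0 by rewrite disc_act mulf_neq0 // expf_neq0.
  have -> : disc (act a b c e d) = t ^+ 4 * disc d1.
    by rewrite E /disc /cscale /=; ring.
  by apply: contra => /eqP->; rewrite mulr0.
have hess_neq0 d1 : cequiv d d1 -> 4 * hess0 d1 * hess2 d1 - hess1 d1 ^+ 2 != 0.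
  by move=> /disc_neq0 ?; rewrite -disc_hess mulf_neq0.
have [d1 [E1 A1]] : exists d1, cequiv d d1 /\ hess0 d1 != 0.
  have dd : cequiv d d.
    rewrite -[d in cequiv _ d]cscale1 -(expr1n K 3) -act_scalar.
    by apply: cequiv_act; rewrite mulr1 mulr0 subr0 oner_neq0.
  have [A0|A0] := eqVneq (hess0 d) 0; last by exists d.
  have [C0|C0] := eqVneq (hess2 d) 0.
    (* The Hessian is a multiple of x y here, and the new first basis vector (1, 1) is not
       isotropic. *)
    exists (act 1 0 1 1 d); split.
      by apply: cequiv_act; rewrite mulr1 mul0r subr0 oner_neq0.
    rewrite hess0_act A0 C0; move: (hess_neq0 _ dd); rewrite A0 C0.
    have -> : 4 * 0 * 0 - hess1 d ^+ 2 = - hess1 d ^+ 2 by ring.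
    rewrite oppr_eq0 sqrf_eq0; have -> // : (1 * 1 - 0 * 1) ^+ 2 *
      (0 * 1 ^+ 2 + hess1 d * 1 * 1 + 0 * 1 ^+ 2) = hess1 d by ring.
  exists (act 0 1 1 0 d); split; first exact: cequiv_act.
  rewrite hess0_act A0; have -> // : (0 * 0 - 1 * 1) ^+ 2 *
      (0 * 0 ^+ 2 + hess1 d * 0 * 1 + hess2 d * 1 ^+ 2) = hess2 d by ring.
have [d2 [E2 A2 B2]] : exists d2, [/\ cequiv d d2, hess0 d2 != 0 & hess1 d2 = 0].
  pose b := - hess1 d1 / (2 * hess0 d1).
  exists (act 1 b 0 1 d1); split.
  - by apply: (cequiv_trans E1); apply: cequiv_act; rewrite mulr1 mulr0 subr0 oner_neq0.
  - rewrite hess0_act; have -> // : (1 * 1 - b * 0) ^+ 2 *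
      (hess0 d1 * 1 ^+ 2 + hess1 d1 * 1 * 0 + hess2 d1 * 0 ^+ 2) = hess0 d1 by ring.
  - by rewrite hess1_act /b; field; rewrite A1 char2.
(* If c30 = 0, then hess0 = c21^2 is nonzero and hess1 = c21 c12 = 0, so c12 = 0; then hess2 = -3
   c21 c03 forces c03 to be nonzero, and an exchange of the coordinates makes it leading. *)
have [F0|F0] := eqVneq (c30 d2) 0; last by exists d2.
have := hess_neq0 _ E2; rewrite B2 expr0n subr0 !mulf_eq0 !negb_or => /andP[_ C2].
exists (act 0 1 1 0 d2); split.
- by apply: (cequiv_trans E2); apply: cequiv_act.
- rewrite hess0_act; have -> // : (0 * 0 - 1 * 1) ^+ 2 *
      (hess0 d2 * 0 ^+ 2 + hess1 d2 * 0 * 1 + hess2 d2 * 1 ^+ 2) = hess2 d2 by ring.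
- by rewrite hess1_act B2; ring.
move: B2 A2 C2; rewrite /hess0 /hess1 /hess2; case: (d2) F0 => f0 f1 f2 f3 g0 g1 /= ->.
have -> : 0 * 0 ^+ 3 + f1 * 0 ^+ 2 * 1 + f2 * 0 * 1 ^+ 2 + f3 * 1 ^+ 3 = f3 by ring.
rewrite mulr0 mul0r subr0 => /eqP; rewrite mulf_eq0 => /orP[]/eqP->.
  have -> : 0 ^+ 2 - 3 * 0 * f2 = 0 by ring.
  by rewrite eqxx.
by move=> _; apply: contra => /eqP->; apply/eqP; ring.
Qed.

(** Once the Hessian is diagonal, scaling the leading coefficient to -1 reads off e and k from the
    middle ones, and hess1 = 0 forces the last one to be e k. The condition k^2 different from e is
    hess0 nonzero. *)
Lemma cequiv_cformC d : res d != 0 -> c10 d = 0 -> c01 d = 0 ->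
  exists e k, paramC e k /\ cequiv d (cformC e k).
Proof.
move=> d0 z0 z1; rewrite (disc_res z0 z1) in d0.
have [d' [E A B F]] := hess_diagonal d0.
have [z0' z1'] := cequiv_ell0 E z0 z1.
have d'0 : res d' != 0 by apply: cequiv_res E _; rewrite disc_res.
exists (c12 d' / (3 * c30 d')), (- c21 d' / (3 * c30 d')); split; last first.
  apply: (cequiv_trans E); exists 1, 0, 0, 1, (- c30 d').
  split; rewrite ?oppr_eq0 //; first by rewrite mulr1 mulr0 subr0 oner_neq0.
  rewrite act_scalar expr1n cscale1; case: d' z0' z1' F B {E A d'0} => f0 f1 f2 f3 g0 g1 /=.
  move=> -> -> f00; rewrite /hess1 /= => B; rewrite /cscale /=.
  congr CForm; try by field; rewrite ?f00 ?char3.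
  have /eqP : (3 * f0) ^+ 2 * (f3 - - f0 * (f2 / (3 * f0) * (- f1 / (3 * f0)))) = 0.
    transitivity (- f0 * (f1 * f2 - 9 * f0 * f3)); last by rewrite B mulr0.
    by field; rewrite ?f00 ?char3.
  rewrite mulf_eq0 expf_eq0 mulf_eq0 (negPf char3) (negPf f00) /= subr_eq0.
  by move/eqP.
move: A; rewrite (disc_res z0' z1') in d'0; move: d'0.
case: d' F B {E z0' z1'} => f0 f1 f2 f3 g0 g1 /= f00; rewrite /hess1 /hess0 /= => B D0 A.
split.
  apply/eqP; rewrite mulf_neq0 ?invr_eq0 ?mulf_neq0 //.
  apply: contra D0 => /eqP z; move: B; rewrite z mulr0 sub0r => /eqP.
  rewrite oppr_eq0 !mulf_eq0 (negPf f00) orbF.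
  have -> : (9 : K) = 3 ^+ 2 by ring.
  rewrite expf_eq0 (negPf char3) /= => /eqP->.
  by rewrite /disc /=; apply/eqP; ring.
move=> h; move/eqP: A; apply.
transitivity ((3 * f0) ^+ 2 * ((- f1 / (3 * f0)) ^+ 2 - f2 / (3 * f0))).
  by field; rewrite ?f00 ?char3.
by rewrite h subrr mulr0.
Qed.

End NormalForms.

(** * Conjugacy among normal forms *)

Section NormalFormClasses.
Variable K : fieldType.
Hypothesis char2 : (2 : K) != 0.
Hypothesis char3 : (3 : K) != 0.

Lemma res_cformB (k b : K) : res (cformB k b) = - 3 ^+ 3 * (b * k).
Proof. by rewrite /res /inv13 /inv22 /hess0 /hess1 /hess2 /disc /=; ring. Qed.

Lemma paramB_res (k b : K) : paramB k b -> res (cformB k b) != 0.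
Proof.
case=> /eqP k0 _ /eqP b0; rewrite res_cformB.
by rewrite !mulf_neq0 // oppr_eq0 expf_neq0.
Qed.

Lemma paramB_neq (k b : K) : paramB k b -> 2 * k + 1 != 0.
Proof.
case=> _ k1 _; apply/negP => /eqP h; apply: k1; apply: (mulfI char2).
by transitivity ((2 * k + 1) - 1); [ring|rewrite h; field].
Qed.

(** Preserving the line x = 0 forces p = 0, and the missing x y^2 term forces c = 0, so the matrix
    is diagonal with entries a, e. The combination (2 k + 1) - 2 (k - 1) = 3 then gives t = a^2 e,
    hence k = k', and b / b' = (a / e)^2. *)
Lemma cequiv_cformB_iff (k b k' b' : K) : paramB k b -> paramB k' b' ->
  cequiv (cformB k b) (cformB k' b') <-> k = k' /\ exists2 c, c != 0 & b / b' = c ^+ 2.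
Proof.
move=> pB pB'; have g0 := paramB_neq pB; have g0' := paramB_neq pB'.
case: pB pB' => _ _ /eqP b0 [_ _ /eqP b0']; split.
  case=> [a [p [c [e [t [D0 t0]]]]]]; rewrite /cscale /= !mulr0 => -[E0 E1 E2 E3 E4 E5].
  have p0 : p = 0.
    move/eqP: E5; rewrite mul0r addr0 !mulf_eq0 (negPf D0) (negPf g0) /=.
    by move/eqP.
  rewrite {}p0 in D0 E1 E2 E3 E4 *; move: D0; rewrite mul0r subr0 mulf_eq0 negb_or.
  move=> /andP[a0 e0].
  have c0 : c = 0.
    have /eqP : 3 * (b * (c * e ^+ 2)) = 0 by rewrite -E2; ring.
    by rewrite !mulf_eq0 (negPf char3) (negPf b0) (negPf e0) /= !orbF => /eqP.
  rewrite {}c0 {E0 E2 E5} in E1 E3 E4.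
  have Ek : t * (2 * k' + 1) = (a ^+ 2 * e) * (2 * k + 1) by rewrite -E4; ring.
  have Ek1 : t * (k' - 1) = (a ^+ 2 * e) * (k - 1) by rewrite -E1; ring.
  have Et : t = a ^+ 2 * e.
    apply: (mulfI char3); transitivity (t * (2 * k' + 1) - 2 * (t * (k' - 1))).
      by ring.
    by rewrite Ek Ek1; ring.
  have kk : k = k'.
    by rewrite -Et in Ek1; apply/esym/(addIr (- 1))/(mulfI t0).
  split=> //; exists (a / e); first by rewrite mulf_neq0 ?invr_eq0.
  have Eb : b * e ^+ 2 = a ^+ 2 * b'.
    by apply: (mulfI e0); transitivity (t * b'); [rewrite -E3; ring|rewrite Et; ring].
  by rewrite expr_div_n; apply/eqP; rewrite eqr_div ?expf_neq0 // Eb.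
case=> <- [c c0 E]; exists c, 0, 0, 1, (c ^+ 2); split.
- by rewrite mulr1 mulr0 subr0.
- by rewrite expf_neq0.
have Eb : b = c ^+ 2 * b' by rewrite -E divfK.
by rewrite /cscale /= [in LHS]Eb; congr CForm; ring.
Qed.

Lemma res_cformC (d k : K) : res (cformC d k) = - (2 ^+ 2 * 3 ^+ 3) * (d * (k ^+ 2 - d) ^+ 2).
Proof. by rewrite /res /inv13 /inv22 /hess0 /hess1 /hess2 /disc /=; ring. Qed.

Lemma paramC_res (d k : K) : paramC d k -> res (cformC d k) != 0.
Proof.
case=> /eqP d0 /eqP kd; rewrite res_cformC.
by rewrite !mulf_neq0 ?oppr_eq0 ?mulf_neq0 ?expf_neq0 ?subr_eq0.
Qed.

Lemma hess_cformC (d k : K) : [/\ hess0 (cformC d k) = 9 * (k ^+ 2 - d),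
  hess1 (cformC d k) = 0 & hess2 (cformC d k) = - 9 * d * (k ^+ 2 - d)].
Proof. by rewrite /hess0 /hess1 /hess2 /=; split; ring. Qed.

Lemma hess_cscale t (d : cform K) : [/\ hess0 (cscale t d) = t ^+ 2 * hess0 d,
  hess1 (cscale t d) = t ^+ 2 * hess1 d & hess2 (cscale t d) = t ^+ 2 * hess2 d].
Proof. by rewrite /hess0 /hess1 /hess2 /=; split; ring. Qed.

(* The Hessian of [cformC d k] is proportional to x^2 - d y^2, which constrains
   the matrix up to the parameters c and mu below. *)
Lemma cequiv_cformC_iff (d k d' k' : K) : paramC d k -> paramC d' k' ->
  cequiv (cformC d k) (cformC d' k') <->
  exists gamma b : K,
    let N := d ^+ 2 * gamma ^+ 3 + 3 * d * k * gamma ^+ 2 + 3 * d * gamma + k in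
    let D := d * k * gamma ^+ 3 + 3 * d * gamma ^+ 2 + 3 * k * gamma + 1 in
    [/\ b <> 0, d' = b ^+ 2 * d
      & (k <> 0 /\ k' = b * d / k) \/ (D <> 0 /\ k' = b * N / D)].
Proof.
move=> [/eqP d0 /eqP kd] [/eqP d0' /eqP kd']; split.
  case=> [a [p [c [e [t [D0 t0 E]]]]]].
  have n9 : (9 : K) != 0 by rewrite (_ : 9 = 3 ^+ 2) ?expf_neq0 //; ring.
  have kd0 : k ^+ 2 - d != 0 by rewrite subr_eq0.
  have kd0' : k' ^+ 2 - d' != 0 by rewrite subr_eq0.
  have [A1 A2 A3] := hess_cformC d k; have [A1' A2' A3'] := hess_cformC d' k'.
  have [B1 B2 B3] := hess_cscale t (cformC d' k').
  have := hess1_act a p c e (cformC d k); have := hess0_act a p c e (cformC d k).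
  have := hess2_act a p c e (cformC d k).
  rewrite E B1 B2 B3 A1 A2 A3 A1' A2' A3' => H2 H0 H1.
  set D := a * e - p * c in D0 H0 H1 H2.
  have X1 : a * p = d * c * e.
    apply/eqP; rewrite -subr_eq0; apply/eqP.
    have z : 2 * D ^+ 2 * 9 * (k ^+ 2 - d) != 0 by rewrite !mulf_neq0 ?expf_neq0.
    apply: (mulfI z); rewrite mulr0 -[RHS](mulr0 (t ^+ 2)) H1; ring.
  have X2 : d' * (a ^+ 2 - d * c ^+ 2) = d * e ^+ 2 - p ^+ 2.
    have z : D ^+ 2 * 9 * (k ^+ 2 - d) != 0 by rewrite !mulf_neq0 ?expf_neq0.
    apply: (mulfI z).
    transitivity (d' * (t ^+ 2 * (9 * (k' ^+ 2 - d')))); first by rewrite H0; ring.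
    transitivity (- (t ^+ 2 * (- 9 * d' * (k' ^+ 2 - d')))); first by ring.
    by rewrite H2; ring.
  have [mu Ep Ee] : exists2 mu, p = mu * d * c & e = mu * a.
    have [a0|a0] := eqVneq a 0; last by
      exists (e / a); [apply: (mulfI a0); rewrite X1; field|field].
    have c0 : c != 0 by apply: contra D0 => /eqP c0; rewrite /D a0 c0 mul0r mulr0 subr0.
    have e0 : e = 0.
      have /eqP : d * c * e = 0 by rewrite -X1 a0 mul0r.
      by rewrite !mulf_eq0 (negPf d0) (negPf c0) => /eqP.
    exists (p / (d * c)); last by rewrite e0 a0 mulr0.
    by field; rewrite d0 c0.
  have {}D0 : mu * (a ^+ 2 - d * c ^+ 2) != 0.
    by apply: contra D0 => /eqP h; rewrite /D Ep Ee -h; apply/eqP; ring.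
  move: (D0); rewrite mulf_eq0 negb_or => /andP[mu0 ac0].
  have Ed' : d' = mu ^+ 2 * d by apply: (mulIf ac0); rewrite X2 Ep Ee; ring.
  move: E; rewrite /cscale /= Ep Ee => -[F0 _ _ F3 _ _].
  (* The parameter gamma is - c / a and b is mu; a = 0 puts gamma at infinity, which produces the
     isolated value b d / k. *)
  have [a0|a0] := eqVneq a 0.
    exists 0, mu; split=> //; [exact/eqP|left].
    rewrite a0 in F0 F3.
    have k0 : k != 0.
      apply: contra t0 => /eqP k0; rewrite k0 in F0.
      by rewrite -oppr_eq0 -mulrN1 -F0; apply/eqP; ring.
    split; first exact/eqP.
    have c0 : c != 0 by apply: contra ac0 => /eqP c0; rewrite a0 c0; apply/eqP; ring.
    have Et : t = - (d * k * c ^+ 3) by apply: oppr_inj; rewrite -mulrN1 -F0; ring.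
    have z : - (d * k * c ^+ 3 * mu ^+ 2 * d) != 0.
      by rewrite oppr_eq0 !mulf_neq0 ?expf_neq0.
    apply: (mulfI z); transitivity (t * (d' * k')); first by rewrite Ed' Et; ring.
    by rewrite -F3; field.
  exists (- c / a), mu; set N := _ + k; set D' := _ + 1; split=> //; [exact/eqP|right].
  have Et : t = a ^+ 3 * D' by apply: oppr_inj; rewrite -mulrN1 -F0 /D'; field.
  have D'0 : D' != 0 by apply: contra t0 => /eqP h; rewrite Et h mulr0.
  split; first exact/eqP.
  have z : mu ^+ 2 * d * a ^+ 3 * D' != 0 by rewrite !mulf_neq0 ?expf_neq0.
  apply: (mulfI z); transitivity (t * (d' * k')); first by rewrite Ed' Et; ring.
  rewrite -F3; transitivity (mu ^+ 3 * d * a ^+ 3 * N); first by rewrite /N; field.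
  by field.
case=> gamma [b /= [/eqP b0 Ed' [[/eqP k0 Ek']|[/eqP D0 Ek']]]].
  exists 0, (b * d), 1, 0, (- (d * k)); split.
  - by rewrite mul0r mulr1 sub0r oppr_eq0 mulf_neq0.
  - by rewrite oppr_eq0 mulf_neq0.
  by rewrite /cscale /= Ed' Ek'; congr CForm; field.
set N := _ + k in Ek'; set D := _ + 1 in D0 Ek'.
(* This makes the matrix below invertible. If d gamma^2 = 1, then N gamma = D, so k' gamma = b and
   k'^2 = d', which is excluded. *)
have g0 : 1 - d * gamma ^+ 2 != 0.
  apply/negP => /eqP h; move/eqP: kd'; apply.
  have {}h : d * gamma ^+ 2 = 1 by rewrite -[RHS](subrK (d * gamma ^+ 2)) h add0r.
  have ND : N * gamma = D.
    transitivity ((d * gamma ^+ 2) ^+ 2 + 3 * k * gamma * (d * gamma ^+ 2)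
      + 3 * (d * gamma ^+ 2) + k * gamma); first by rewrite /N; ring.
    transitivity (k * gamma * (d * gamma ^+ 2) + 3 * (d * gamma ^+ 2)
      + 3 * k * gamma + 1); last by rewrite /D; ring.
    by rewrite h; ring.
  have gamma0 : gamma != 0.
    by apply/negP => /eqP z; move/eqP: h; rewrite z expr0n mulr0 eq_sym oner_eq0.
  have kb : k' * gamma = b by rewrite Ek' mulrAC -(mulrA b) ND mulfK.
  apply: (@mulIf _ (gamma ^+ 2)); first by rewrite expf_neq0.
  by rewrite Ed' -(mulrA (b ^+ 2)) h mulr1 -kb exprMn.
exists 1, (- b * d * gamma), (- gamma), b, D; split=> //.
  have -> : 1 * b - - b * d * gamma * - gamma = b * (1 - d * gamma ^+ 2) by ring.
  by rewrite mulf_neq0.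
by rewrite /cscale /= Ed' Ek'; congr CForm; rewrite /N /D; field.
Qed.

End NormalFormClasses.

Lemma closed_root (L : closedFieldType) n (x : L) :
  (0 < n)%N -> exists y, y ^+ n = x.
Proof.
move=> n0; have [y Ey] := @solve_monicpoly L n (fun i => if i == 0%N then x else 0) n0.
exists y; rewrite Ey; case: n n0 {Ey} => // n _.
by rewrite big_ord_recl /= expr0 mulr1 big1 ?addr0 // => i _; rewrite mul0r.
Qed.

(* Over a closed field [cformC d k] is equivalent to the sum of two cubes. *)
Lemma cequiv_cformC_closed (L : closedFieldType) (d k d' k' : L) :
  (2 : L) != 0 -> paramC d k -> paramC d' k' -> cequiv (cformC d k) (cformC d' k').
Proof.
move=> char2.
suff cubes (e l : L) : paramC e l -> cequiv (CForm 1 0 0 1 0 0) (cformC e l).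
  by move=> /cubes/cequiv_sym h /cubes; apply: cequiv_trans.
case=> /eqP e0 le; have [s Es] := closed_root e (isT : (0 < 2)%N).
(* The negated cubic of [cformC e l] should be x^3 (X + s Y)^3 + y^3 (X - s Y)^3; its first two
   coefficients require x^3 + y^3 = 1 and x^3 - y^3 = - l / s. *)
have [x Ex] := closed_root ((1 - l / s) / 2) (isT : (0 < 3)%N).
have [y Ey] := closed_root ((1 + l / s) / 2) (isT : (0 < 3)%N).
have s0 : s != 0 by apply: contra e0 => /eqP s0; rewrite -Es s0 expr0n.
have x0 : x != 0.
  apply/negP => /eqP x0; apply: le; rewrite -Es.
  have -> : l = s - 2 * s * ((1 - l / s) / 2) by field; rewrite s0 char2.
  by rewrite -Ex x0 expr0n mulr0 subr0.
have y0 : y != 0.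
  apply/negP => /eqP y0; apply: le; rewrite -Es.
  have -> : l = 2 * s * ((1 + l / s) / 2) - s by field; rewrite s0 char2.
  by rewrite -Ey y0 expr0n mulr0 sub0r sqrrN.
exists x, (x * s), y, (- y * s), (- 1); split.
- have -> : x * (- y * s) - x * s * y = - (2 * s * x * y) by ring.
  by rewrite oppr_eq0 !mulf_neq0.
- by rewrite oppr_eq0 oner_eq0.
rewrite /cscale /= -Es; congr CForm; try by ring.
- by transitivity (x ^+ 3 + y ^+ 3); [ring|rewrite Ex Ey; field; rewrite s0 char2].
- by transitivity (3 * s * (x ^+ 3 - y ^+ 3)); [ring|rewrite Ex Ey; field; rewrite s0 char2].
- by transitivity (3 * s ^+ 2 * (x ^+ 3 + y ^+ 3));
    [ring|rewrite Ex Ey; field; rewrite s0 char2].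
by transitivity (s ^+ 3 * (x ^+ 3 - y ^+ 3)); [ring|rewrite Ex Ey; field; rewrite s0 char2].
Qed.

(** * Descent of the three cases to the base field *)

Section Classification.
Variables (K L : fieldType) (iota : {rmorphism K -> L}).
Hypothesis char2 : (2 : K) != 0.
Hypothesis char3 : (3 : K) != 0.
Implicit Types d : cform K.

Let char2L : (2 : L) != 0.
Proof. by rewrite -(rmorph_nat iota) fmorph_eq0. Qed.

Let char3L : (3 : L) != 0.
Proof. by rewrite -(rmorph_nat iota) fmorph_eq0. Qed.

Lemma res_cmap_neq0 d : res d != 0 -> res (cmap iota d) != 0.
Proof. by rewrite res_cmap fmorph_eq0. Qed.

Lemma has_fixdata_sym_functions d (l1 l2 l3 : L) :
  res d != 0 -> has_fixdata (cmap iota d) l1 l2 l3 ->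
  sym_functions iota l1 l2 l3 ((3 * inv13 d - 6 * disc d) / res d)
                 ((3 * inv13 d + 3 * inv22 d + 12 * disc d) / res d).
Proof.
move=> d0 /has_fixdata_sym [E1 E2 _].
have i13 : inv13 (cmap iota d) = iota (inv13 d) by rewrite /inv13 /=; ring.
have i22 : inv22 (cmap iota d) = iota (inv22 d).
  by rewrite /inv22 /hess0 /hess1 /hess2 /=; ring.
have ids : disc (cmap iota d) = iota (disc d) by rewrite /disc /=; ring.
have r0 := res_cmap_neq0 d0.
by split; apply: (mulIf r0); rewrite ?E1 ?E2 res_cmap -rmorphM divfK // i13 ?i22 ids; ring.
Qed.

Lemma cmap_ell_normal (f0 f1 f2 f3 : K) : cmap iota (CForm f0 f1 f2 f3 0 1)
  = CForm (iota f0) (iota f1) (iota f2) (iota f3) 0 1.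
Proof. by rewrite /cmap /= rmorph0 rmorph1. Qed.

Lemma iota_harm (f0 f1 f2 f3 : K) :
  harm (iota f0) (iota f1) (iota f2) (iota f3) = iota (harm f0 f1 f2 f3).
Proof. by rewrite /harm; ring. Qed.

Lemma not_caseC_ell d (l1 l2 l3 : L) : res d != 0 ->
  has_fixdata (cmap iota d) l1 l2 l3 -> ~ caseC l1 l2 l3 ->
  exists f0 f1 f2 f3, cequiv d (CForm f0 f1 f2 f3 0 1).
Proof.
move=> d0 h nC; apply: cequiv_ell; apply/contraT.
rewrite negb_or !negbK => /andP[/eqP z0 /eqP z1]; case: nC.
by apply: ell0_caseC (res_cmap_neq0 d0) h _ _; rewrite /= ?z0 ?z1 rmorph0.
Qed.

Lemma caseA_cequiv d (l1 l2 l3 : L) : res d != 0 ->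
  has_fixdata (cmap iota d) l1 l2 l3 -> caseA l1 l2 l3 ->
  exists s1 s2 : K, sym_functions iota l1 l2 l3 s1 s2 /\ cequiv d (cformA s1 s2).
Proof.
move=> d0 h A.
have [f0 [f1 [f2 [f3 E]]]] := not_caseC_ell d0 h (caseA_notC char3L A).
have {}h := has_fixdata_cequiv (cequiv_cmap iota E) h.
have n0 := cequiv_res E d0.
have s := has_fixdata_sym_functions n0 h.
do 2!eexists; split; [exact: s|apply: (cequiv_trans E); apply: cequiv_cformA => //].
rewrite -(fmorph_eq0 iota) -iota_harm; move: h (res_cmap_neq0 n0).
by rewrite cmap_ell_normal => h r0; apply: caseA_harm h A.
Qed.

Lemma caseB_cequiv d (l1 l2 l3 : L) : res d != 0 ->
  has_fixdata (cmap iota d) l1 l2 l3 -> caseB l1 l2 l3 ->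
  exists k b : K, [/\ paramB k b, iota k = (l1 + 1) / 2 & cequiv d (cformB k b)].
Proof.
move=> d0 h B.
have [f0 [f1 [f2 [f3 E]]]] := not_caseC_ell d0 h (caseB_notC char3L B).
have n0 := cequiv_res E d0.
have h0 : harm f0 f1 f2 f3 = 0.
  apply/eqP; rewrite -(fmorph_eq0 iota) -iota_harm; apply/eqP.
  move: (has_fixdata_cequiv (cequiv_cmap iota E) h) (res_cmap_neq0 n0).
  by rewrite cmap_ell_normal => h' r0; apply: caseB_harm h' B.
have [g2 E'] := harm0_depressed char2 char3 n0 h0.
have {E E'} E := cequiv_trans E E'.
have {}n0 := cequiv_res E d0; have [g20 pB E'] := cequiv_cformB char2 char3 n0.
do 2!eexists; split; [exact: pB| |exact: cequiv_trans E E'].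
have f00 : f0 != 0.
  by move: pB => [_ _ /eqP]; rewrite !mulf_eq0 !negb_or => /andP[/andP[]].
move: (has_fixdata_cequiv (cequiv_cmap iota E) h) (res_cmap_neq0 n0).
rewrite cmap_ell_normal rmorph0 => h' r0.
have i0 : iota f0 != 0 by rewrite fmorph_eq0.
have := caseB_multiplier char3L char2L r0 i0 h' B.
have ig20 : 1 + 2 * iota g2 != 0.
  have -> : 1 + 2 * iota g2 = iota (1 + 2 * g2) by ring.
  by rewrite fmorph_eq0.
move=> M; rewrite fmorph_div.
have -> : iota (1 - g2) = 1 - iota g2 by ring.
have -> : iota (1 + 2 * g2) = 1 + 2 * iota g2 by ring.
apply: (mulIf ig20); rewrite divfK //.
transitivity ((l1 * (1 + 2 * iota g2) + (1 + 2 * iota g2)) / 2); last by field.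
by rewrite M; field.
Qed.

Lemma caseC_cequiv d (l1 l2 l3 : L) : res d != 0 ->
  has_fixdata (cmap iota d) l1 l2 l3 -> caseC l1 l2 l3 ->
  exists e k : K, paramC e k /\ cequiv d (cformC e k).
Proof.
move=> d0 h [e1 e2 e3]; rewrite e1 e2 e3 in h.
have [z0 z1] := caseC_ell0 char3L (res_cmap_neq0 d0) h.
by apply: cequiv_cformC => //; apply/eqP; rewrite -(fmorph_eq0 iota); apply/eqP.
Qed.

Lemma cmap_cformB (k b : K) : cmap iota (cformB k b) = cformB (iota k) (iota b).
Proof. by rewrite /cmap /=; congr CForm; ring. Qed.

Lemma cmap_cformC (e k : K) : cmap iota (cformC e k) = cformC (iota e) (iota k).
Proof. by rewrite /cmap /=; congr CForm; ring. Qed.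

Lemma paramB_iota (k b : K) : paramB k b -> paramB (iota k) (iota b).
Proof.
case=> k0 k1 b0; split.
- by apply/eqP; rewrite fmorph_eq0; apply/eqP.
- have -> : - (1 / 2) = iota (- (1 / 2)) by rewrite rmorphN fmorph_div rmorph1 rmorph_nat.
  by move/fmorph_inj.
- by apply/eqP; rewrite fmorph_eq0; apply/eqP.
Qed.

Lemma paramC_iota (e k : K) : paramC e k -> paramC (iota e) (iota k).
Proof.
case=> e0 ke; split; first by apply/eqP; rewrite fmorph_eq0; apply/eqP.
by rewrite -rmorphXn => /fmorph_inj.
Qed.

End Classification.

(** * Translation back to rational maps *)

Section ConjugateForms.
Variables (K : fieldType) (L : closedFieldType) (iota : {rmorphism K -> L}).
Hypothesis char3 : (3 : K) != 0.
Implicit Types d : cform K.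

Let char3L : (3 : L) != 0.
Proof. by rewrite -(rmorph_nat iota) fmorph_eq0. Qed.

Lemma multipliers3_fixdata d (l1 l2 l3 : L) : res d != 0 ->
  multipliers3 iota (qmap d) l1 l2 l3 -> has_fixdata (cmap iota d) l1 l2 l3.
Proof.
move=> d0; rewrite /multipliers3 ratmap_qmap //.
exact/fix_multipliers_fixdata/res_cmap_neq0.
Qed.

Lemma conjugate_over_cequiv d d' : res d != 0 -> res d' != 0 ->
  conjugate_over iota (qmap d) (qmap d') <-> cequiv (cmap iota d) (cmap iota d').
Proof.
move=> /[dup] d0 /(res_cmap_neq0 iota) r0 /[dup] d'0 /(res_cmap_neq0 iota) r'0.
rewrite /conjugate_over !ratmap_qmap //; split.
  exact: conjugate_cequiv.
exact: cequiv_conjugate.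
Qed.

(** The form of psi is equivalent to [cformA] of its own symmetric functions, which therefore
    inherits the multipliers. So s1 and s2 can be recovered from the normal form itself. *)
Lemma paramA_fixdata (s1 s2 : K) : (2 : K) != 0 -> paramA iota s1 s2 ->
  res (cformA s1 s2) != 0 /\ exists l1 l2 l3 : L,
    has_fixdata (cmap iota (cformA s1 s2)) l1 l2 l3 /\ sym_functions iota l1 l2 l3 s1 s2.
Proof.
move=> char2 [psi [l1 [l2 [l3 [/ratdeg2_qmap-/(_ char3)[d d0 ->]]]]]].
move=> /(multipliers3_fixdata d0) h A [S1 S2].
have [s1' [s2' [[S1' S2'] E]]] := caseA_cequiv char2 char3 d0 h A.
move: (S1) (S2) E; rewrite -S1' -S2' => /fmorph_inj <- /fmorph_inj <- E.
split; first exact: cequiv_res E d0.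
exists l1, l2, l3; split=> //.
exact: has_fixdata_cequiv (cequiv_cmap iota E) h.
Qed.

End ConjugateForms.

Theorem theorem1 (K : fieldType) (char2 : 2%N \notin [pchar K])
    (char3 : 3%N \notin [pchar K])
    (Kbar : closedFieldType) (iota : {rmorphism K -> Kbar})
    (Kbar_alg : forall x : Kbar, algebraicOver iota x) :
  (* (a) *)
  ((forall (psi : {fraction {poly K}}) (l1 l2 l3 : Kbar),
      ratdeg psi = 2%N -> multipliers3 iota psi l1 l2 l3 -> caseA l1 l2 l3 ->
      exists s1 s2 : K,
        sym_functions iota l1 l2 l3 s1 s2 /\ conjugate psi (phiA s1 s2))
   /\
   (forall s1 s2 t1 t2 : K,
      paramA iota s1 s2 -> paramA iota t1 t2 -> phiA s1 s2 <> phiA t1 t2 ->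
      ~ conjugate_over iota (phiA s1 s2) (phiA t1 t2)))
  /\
  (* (b) *)
  ((forall (psi : {fraction {poly K}}) (l1 l2 l3 : Kbar),
      ratdeg psi = 2%N -> multipliers3 iota psi l1 l2 l3 -> caseB l1 l2 l3 ->
      exists k b : K,
        [/\ paramB k b, iota k = (l1 + 1) / 2 & conjugate psi (phiB k b)])
   /\
   (forall k b k' b' : K, paramB k b -> paramB k' b' ->
      (conjugate_over iota (phiB k b) (phiB k' b') <-> k = k')
      /\
      (conjugate (phiB k b) (phiB k' b') <->
         k = k' /\ exists2 c : K, c <> 0 & b / b' = c ^+ 2)))
  /\
  (* (c) *)
  ((forall (psi : {fraction {poly K}}) (l1 l2 l3 : Kbar),
      ratdeg psi = 2%N -> multipliers3 iota psi l1 l2 l3 -> caseC l1 l2 l3 ->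
      exists d k : K, paramC d k /\ conjugate psi (thetaC d k))
   /\
   (forall d k d' k' : K, paramC d k -> paramC d' k' ->
      conjugate_over iota (thetaC d k) (thetaC d' k')
      /\
      (conjugate (thetaC d k) (thetaC d' k') <->
         exists gamma b : K,
           let N := d ^+ 2 * gamma ^+ 3 + 3 * d * k * gamma ^+ 2
                    + 3 * d * gamma + k in
           let D := d * k * gamma ^+ 3 + 3 * d * gamma ^+ 2
                    + 3 * k * gamma + 1 in
           [/\ b <> 0, d' = b ^+ 2 * d
             & (k <> 0 /\ k' = b * d / k) \/ (D <> 0 /\ k' = b * N / D)])))
  /\
  (* every quadratic map falls into exactly one of the three cases *)
  (forall psi : {fraction {poly K}}, ratdeg psi = 2%N ->
     let inA := in_case iota (@caseA Kbar) psi in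
     let inB := in_case iota (@caseB Kbar) psi in
     let inC := in_case iota (@caseC Kbar) psi in
     [\/ inA, inB | inC] /\ [/\ ~ (inA /\ inB), ~ (inA /\ inC) & ~ (inB /\ inC)]).
Proof.
have c2 : (2 : K) != 0 by apply: contra char2 => h; rewrite inE /= h.
have c3 : (3 : K) != 0 by apply: contra char3 => h; rewrite inE /= h.
have c3L : (3 : Kbar) != 0 by rewrite -(rmorph_nat iota) fmorph_eq0.
have c2L : (2 : Kbar) != 0 by rewrite -(rmorph_nat iota) fmorph_eq0.
split; [split|split; [split|split; [split|]]].
- move=> psi l1 l2 l3 /(ratdeg2_qmap c3)[d d0 ->] /(multipliers3_fixdata c3 d0) h A.
  have [s1 [s2 [S E]]] := caseA_cequiv c2 c3 d0 h A.
  by exists s1, s2; split=> //; rewrite phiA_qmap //; apply: cequiv_conjugate.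
- move=> s1 s2 t1 t2 /(paramA_fixdata c3 c2)[s0 [l1 [l2 [l3 [hl [S1 S2]]]]]].
  move=> /(paramA_fixdata c3 c2)[t0 [m1 [m2 [m3 [hm [T1 T2]]]]]].
  rewrite !phiA_qmap // => neq /(conjugate_over_cequiv iota c3 s0 t0) E; apply: neq.
  have r0 := res_cmap_neq0 iota t0.
  (* Both triples are now multipliers of one form over the closure, so their symmetric functions
     agree. *)
  have [E1 E2 _] := has_fixdata_sym (has_fixdata_cequiv E hl).
  have [F1 F2 _] := has_fixdata_sym hm.
  rewrite -F1 in E1; rewrite -F2 in E2.
  move: (mulIf r0 E1) (mulIf r0 E2); rewrite -S1 -T1 -S2 -T2.
  by move=> /fmorph_inj-> /fmorph_inj->.
- move=> psi l1 l2 l3 /(ratdeg2_qmap c3)[d d0 ->] /(multipliers3_fixdata c3 d0) h B.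
  have [k [b [pB Ek E]]] := caseB_cequiv c2 c3 d0 h B.
  by exists k, b; split=> //; rewrite phiB_qmap //; apply: cequiv_conjugate.
- move=> k b k' b' pB pB'; rewrite !phiB_qmap //.
  have r0 := paramB_res c3 pB; have r0' := paramB_res c3 pB'.
  have iff := cequiv_cformB_iff c2 c3 pB pB'.
  split; last first.
    split=> [/(conjugate_cequiv c3 r0 r0') /iff[-> [c /eqP c0 Ec]]|[kk [c /eqP c0 Ec]]].
      by split=> //; exists c.
    by apply: cequiv_conjugate => //; apply/iff; split=> //; exists c.
  have pL := paramB_iota iota pB; have pL' := paramB_iota iota pB'.
  have iffL := cequiv_cformB_iff c2L c3L pL pL'.
  split=> [/(conjugate_over_cequiv iota c3 r0 r0')|kk].
    by rewrite !cmap_cformB => /iffL[/fmorph_inj].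
  apply/(conjugate_over_cequiv iota c3 r0 r0'); rewrite !cmap_cformB.
  apply/iffL; split; first by rewrite kk.
  (* Over the closure the square class condition on b / b' is always met. *)
  have [c Ec] := closed_root (iota b / iota b') (isT : (0 < 2)%N).
  exists c => //; apply/negP => /eqP z; move: Ec; rewrite z expr0n => /esym/eqP.
  case: pL pL' => _ _ /eqP bL [_ _ /eqP bL'].
  by rewrite mulf_eq0 invr_eq0 (negPf bL) (negPf bL').
- move=> psi l1 l2 l3 /(ratdeg2_qmap c3)[d d0 ->] /(multipliers3_fixdata c3 d0) h C.
  have [e [k [pC E]]] := caseC_cequiv c2 c3 d0 h C.
  by exists e, k; split=> //; rewrite thetaC_qmap //; apply: cequiv_conjugate.
- move=> d k d' k' pC pC'; rewrite !thetaC_qmap //.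
  have r0 := paramC_res c2 c3 pC; have r0' := paramC_res c2 c3 pC'.
  split.
    apply/(conjugate_over_cequiv iota c3 r0 r0'); rewrite !cmap_cformC.
    by apply: cequiv_cformC_closed => //; apply: paramC_iota.
  apply: iff_trans (cequiv_cformC_iff c2 c3 pC pC').
  by split; [apply: conjugate_cequiv|apply: cequiv_conjugate].
move=> psi /(ratdeg2_qmap c3)[d d0 ->] inA inB inC.
have perm l1 l2 l3 m1 m2 m3 : multipliers3 iota (qmap d) l1 l2 l3 ->
    multipliers3 iota (qmap d) m1 m2 m3 -> perm_eq [:: m1; m2; m3] [:: l1; l2; l3].
  by move=> hl hm; apply: fix_multipliers_uniq hm hl.
split; last split.
- have [l1 [l2 [l3 h]]] := fix_multipliers_exist c3L (res_cmap_neq0 iota d0).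
  have h' := fix_multipliers_fixdata c3L (res_cmap_neq0 iota d0) h.
  have rel := has_fixdata_prod (res_cmap_neq0 iota d0) h'.
  have [m1 [m2 [m3 [p cases]]]] := multiplier_trichotomy rel.
  have hm : multipliers3 iota (qmap d) m1 m2 m3.
    by rewrite /multipliers3 ratmap_qmap //; apply: fix_multipliers_perm p h.
  by case: cases => c; [constructor 1|constructor 2|constructor 3]; exists m1, m2, m3.
- move=> [[l1 [l2 [l3 [h A]]]] [m1 [m2 [m3 [h' B]]]]].
  exact: caseA_notB (caseA_perm (perm _ _ _ _ _ _ h h') A) B.
- move=> [[l1 [l2 [l3 [h A]]]] [m1 [m2 [m3 [h' C]]]]].
  by have /(caseA_notC c3L) := caseA_perm (perm _ _ _ _ _ _ h h') A; apply.
move=> [[l1 [l2 [l3 [h B]]]] [m1 [m2 [m3 [h' C]]]]].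
by have := caseC_perm (perm _ _ _ _ _ _ h' h) C; apply: caseB_notC B.
Qed.
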